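(* Let $X/S$ be a smooth morphism of schemes in characteristic $p>0$ with a lifting $\tilde X'/\tilde S$ of $X'/S$ modulo $p^2$. Let $\tilde U$ be a lift (smooth over $\tilde S$) of some open subset $U$ of $X$, let $\tilde F\colon\tilde U\to\tilde X'$ be a lifting of the relative Frobenius $F_{X/S}|_U$, let $\sigma_{\tilde F}$ be the corresponding splitting of the extension $0\to\mathcal O_U\to\mathcal E_{\mathcal X/\mathcal S,U}\to F_{X/S}^*\Omega^1_{X'/S}|_U\to0$, and let $\zeta_{\tilde F}\colon\Omega^1_{X'/S}\to F_{X/S*}\Omega^1_{X/S}$ be the map (over $U$) defined by $\tilde F$. Then for any local section $\omega'$ of $\Omega^1_{X'/S}$, $$\nabla(\sigma_{\tilde F}(1\otimes\omega'))=-\zeta_{\tilde F}(\omega'),$$ where $\nabla$ is the canonical connection on $\mathcal E_{\mathcal X/\mathcal S}$ and the right-hand side is viewed in $\Omega^1_{X/S}=\mathcal O_X\otimes\Omega^1_{X/S}\subseteq\mathcal E_{\mathcal X/\mathcal S}\otimes\Omega^1_{X/S}$.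
   Context: Setup. $X':=X\times_{S,F_S}S$, $F_{X/S}\colon X\to X'$ the relative Frobenius. A lifting of $X'/S$ modulo $p^2$: $\tilde S$ is a flat $\mathbf Z/p^2$-scheme with $S\subset\tilde S$ defined by $p$, and $\tilde X'\to\tilde S$ is flat (hence smooth) with reduction $X'\to S$. $[p]$ denotes the injection $M\to\tilde M$ induced by multiplication by $p$, where $\tilde M$ is flat over $\mathbf Z/p^2$ and $M=\tilde M/p\tilde M$. The torsor. For an open $U\subseteq X$ and a smooth lifting $\tilde U/\tilde S$ of $U/S$, the liftings $\tilde F\colon\tilde U\to\tilde X'$ of $F_{X/S}|_U$ form an $F_{X/S}^*T_{X'/S}$-torsor, canonically independent of $\tilde U$; $\xi=\tilde F_2-\tilde F_1$ is characterized by $\tilde F_2^*(\tilde a')-\tilde F_1^*(\tilde a')=[p]\langle\xi,F_{X/S}^*da'\rangle$ for $\tilde a'\in\mathcal O_{\tilde X'}$ lifting $a'$. These glue to a torsor on $X$ represented by an affine $X$-scheme $\pi_{\mathcal L}\colon\mathcal L\to X$; $\mathcal A_{\mathcal X/\mathcal S}:=\pi_{\mathcal L*}\mathcal O_{\mathcal L}$ and $\mathcal E_{\mathcal X/\mathcal S}=N_1\mathcal A_{\mathcal X/\mathcal S}\subseteq\mathcal A_{\mathcal X/\mathcal S}$ is the $\mathcal O_X$-submodule of affine functions on the torsor. It fits in a canonical exact sequence $0\to\mathcal O_X\to\mathcal E_{\mathcal X/\mathcal S}\to F_{X/S}^*\Omega^1_{X'/S}\to0$. The splitting $\sigma_{\tilde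 F}\colon F_{X/S}^*\Omega^1_{X'/S}\to\mathcal E_{\mathcal X/\mathcal S}$ sends $\omega$ to the function $\tilde F'\mapsto\langle\omega,\tilde F'-\tilde F\rangle$; i.e. $[p]\,\sigma_{\tilde F}(F_{X/S}^*da')(\tilde F')=\tilde F'^*(\tilde a')-\tilde F^*(\tilde a')$. The connection. The same recipe, applied to PD thickenings, makes the torsor, $\mathcal A_{\mathcal X/\mathcal S}$ and $\mathcal E_{\mathcal X/\mathcal S}$ crystals on $X/S$ and hence gives them integrable connections. Concretely: let $\tilde T$ be the first infinitesimal neighbourhood of the diagonal in $\tilde U\times_{\tilde S}\tilde U$ with projections $\tilde h_1,\tilde h_2$, and $T$ its reduction modulo $p$ (so $\mathcal O_T\cong\mathcal O_U\oplus\Omega^1_{U/S}$). On $T$ one has $F_{X/S}\circ h_1=F_{X/S}\circ h_2$; both pullbacks $h_i^*\mathcal L$ are identified with the torsor of liftings of this map to $\tilde T$ via $\tilde F\mapsto\tilde F\circ\tilde h_i$, giving $h_2^*\mathcal E\cong h_1^*\mathcal E$, and $\nabla(e)=h_2^*(e)-h_1^*(e)$. The map $\zeta_{\tilde F}$: since $d\tilde F\colon\Omega^1_{\tilde X'/\tilde S}\to\tilde F_*\Omega^1_{\tilde U/\tilde S}$ is divisible by $p$, there is a unique map $\zeta_{\tilde F}\colon\Omega^1_{X'/S}\to F_{X/S*}\Omega^1_{X/S}$ (over $U$) such that $d\tilde F$ is the composite of reduction modulo $p$, $\zeta_{\tilde F}$ and $[p]$. *)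

(* Defs.v *)
(* MathComp and MathComp-Analysis.

   Sheaves are given by their "espace etale": a family of stalks together with
   the predicate saying that a family of germs is a section near a point.  A
   section over an open V is then a family of germs that is regular at every
   point of V, and restriction to a smaller open set is invisible. *)
From HB Require Import structures.
From mathcomp Require Import all_boot all_algebra.
From mathcomp Require Import boolp classical_sets topology.
From mathcomp Require Import -(notations) mpoly.

Set Implicit Arguments.
Unset Strict Implicit.
Unset Printing Implicit Defensive.
Import GRing.Theory.
Local Open Scope classical_set_scope.
Local Open Scope ring_scope.

(** * Commutative algebra *)

Definition invertible (A : comPzRingType) (a : A) : Prop := exists b, a * b = 1.

Definition local_ring (A : comPzRingType) : Prop :=
  ~ invertible (0 : A) /\
  forall a b : A, invertible (a + b) -> invertible a \/ invertible b.

Definition ring_hom (A B : pzRingType) (f : A -> B) : Prop :=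
  zmod_morphism f /\ monoid_morphism f.

Definition prime_ideal (A : comPzRingType) (P : set A) : Prop :=
  [/\ P 0, ~ P 1, forall a b, P a -> P b -> P (a - b),
      forall a b, P b -> P (a * b) &
      forall a b, P (a * b) -> P a \/ P b].

(* I ^ 2 *)
Definition ideal_square (A : comPzRingType) (I : set A) : set A :=
  [set a | exists s : seq (A * A),
    (forall c, c \in s -> I c.1 /\ I c.2) /\ a = \sum_(c <- s) c.1 * c.2].

Definition semilinear (A B : pzRingType) (f : A -> B)
    (M : lmodType A) (N : lmodType B) (g : M -> N) : Prop :=
  zmod_morphism g /\ forall a m, g (a *: m) = f a *: g m.

(* As [semilinear], with values in the ring [B] itself. *)
Definition semilinear_form (A B : pzRingType) (f : A -> B)
    (M : lmodType A) (g : M -> B) : Prop :=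
  zmod_morphism g /\ forall a m, g (a *: m) = f a * g m.

(* B is an A-algebra through f. *)
Definition balanced (A B : comPzRingType) (f : A -> B) (M : lmodType A)
    (T : zmodType) (t : B -> M -> T) : Prop :=
  [/\ forall m, zmod_morphism (t^~ m), forall b, zmod_morphism (t b) &
      forall b a m, t (b * f a) m = t b (a *: m)].

(* (T, t) is the tensor product of B and M over A. *)
Definition is_tensor (A B : comPzRingType) (f : A -> B) (M : lmodType A)
    (T : zmodType) (t : B -> M -> T) : Prop :=
  balanced f t /\
  forall (T' : zmodType) (t' : B -> M -> T'), balanced f t' ->
    exists! u : T -> T', zmod_morphism u /\ forall b m, u (t b m) = t' b m.

Definition flat_hom (A B : comPzRingType) (f : A -> B) : Prop :=
  forall (M N : lmodType A) (g : M -> N), semilinear id g -> injective g ->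
  forall (T1 T2 : zmodType) (t1 : B -> M -> T1) (t2 : B -> N -> T2),
    is_tensor f t1 -> is_tensor f t2 ->
  forall u : T1 -> T2, zmod_morphism u ->
    (forall b m, u (t1 b m) = t2 b (g m)) -> injective u.

(* A = B[x_1, ..., x_(c + r)] / (f_1, ..., f_c) with the Jacobian determinant of
   the f_j with respect to x_1, ..., x_c invertible in A. *)
Definition standard_smooth (B A : comNzRingType) (g : {rmorphism B -> A}) :=
  exists (c r : nat) (v : 'I_(c + r) -> A)
         (f : 'I_c -> mpoly.mpoly (c + r) B),
    let ev := mpoly.mmap g v in
    [/\ forall a : A, exists P, ev P = a,
        forall P, ev P = 0 <->
          exists q : 'I_c -> mpoly.mpoly (c + r) B, P = \sum_j q j * f j &
        invertible
          (\det (\matrix_(i < c, j < c) ev (mpoly.mderiv (lshift r i) (f j))))].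

Definition derivation (A B : comPzRingType) (f : A -> B) (M : lmodType B)
    (D : B -> M) : Prop :=
  [/\ zmod_morphism D, forall a b, D (a * b) = a *: D b + b *: D a &
      forall a, D (f a) = 0].

(* (M, d) is the module of Kahler differentials of B over A. *)
Definition is_kahler (A B : comPzRingType) (f : A -> B) (M : lmodType B)
    (d : B -> M) : Prop :=
  derivation f d /\
  forall (N : lmodType B) (D : B -> N), derivation f D ->
    exists! g : M -> N, semilinear id g /\ forall b, g (d b) = D b.

(* If A is a flat Z/p^2-module and red : A -> B is its reduction modulo p, this
   is the injection [p] : B -> A induced by multiplication by p. *)
Definition times_p (p : nat) (A B : zmodType) (red : A -> B) (b : B) : A :=
  xget 0 [set c | exists a, red a = b /\ c = a *+ p].

(** * Ringed spaces, schemes and sheaves of modules *)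

Section Sheaf.
Variables (X : topologicalType) (F : X -> Type).
Variable reg : (forall x, F x) -> X -> Prop.

Definition is_sheaf : Prop :=
  [/\ forall s x, reg s x -> \forall y \near x, reg s y,
      forall s t x, reg s x -> (\forall y \near x, s y = t y) -> reg t x,
      forall x (a : F x), exists s, reg s x /\ s x = a &
      forall s t x, reg s x -> reg t x -> s x = t x ->
        \forall y \near x, s y = t y].

End Sheaf.

Record ringed_space := RingedSpace {
  space :> topologicalType;
  stalk : space -> comPzRingType;
  regular : (forall x, stalk x) -> space -> Prop;
  regular_sheaf : is_sheaf regular;
  regular1 : forall x, regular (fun=> 1) x;
  regularB : forall s t x, regular s x -> regular t x ->
    regular (fun y => s y - t y) x;
  regularM : forall s t x, regular s x -> regular t x ->
    regular (fun y => s y * t y) x }.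

Record module_sheaf (X : ringed_space) := ModuleSheaf {
  mstalk :> forall x : X, lmodType (stalk x);
  mregular : (forall x, mstalk x) -> X -> Prop;
  mregular_sheaf : is_sheaf mregular;
  mregularB : forall s t x, mregular s x -> mregular t x ->
    mregular (fun y => s y - t y) x;
  mregularZ : forall a s x, regular a x -> mregular s x ->
    mregular (fun y => a y *: s y) x }.

Definition locally_ringed (X : ringed_space) : Prop :=
  forall x : X, local_ring (stalk x).

(* The data underlying a morphism.  A morphism defined on an open subset only
   is represented by a raw morphism whose values elsewhere are irrelevant. *)
Record raw_morphism (X Y : ringed_space) := RawMorphism {
  on_pt :> X -> Y;
  on_stalk : forall x, stalk (on_pt x) -> stalk x }.

(* f is, over the open subset W, a morphism of locally ringed spaces. *)
Definition morphism_on (X Y : ringed_space) (W : set X)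
    (f : raw_morphism X Y) : Prop :=
  forall x, W x ->
    [/\ {for x, continuous f},
        ring_hom (@on_stalk _ _ f x),
        forall a, invertible (on_stalk (r := f) (x := x) a) -> invertible a &
        forall s, regular s (f x) -> regular (fun y => on_stalk (s (f y))) x].

Definition morphism (X Y : ringed_space) (f : raw_morphism X Y) : Prop :=
  morphism_on setT f.

(* Since a germ is the value at a point of a family of germs, letting the two
   pullbacks act on such families compares them without any transport along
   the equality f x = g x. *)
Definition eq_mor_on (X Y : ringed_space) (W : set X)
    (f g : raw_morphism X Y) : Prop :=
  forall x, W x -> f x = g x /\
    forall s : forall y, stalk y,
      on_stalk (r := f) (x := x) (s (f x)) = on_stalk (r := g) (s (g x)).

Definition eq_mor (X Y : ringed_space) (f g : raw_morphism X Y) : Prop :=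
  eq_mor_on setT f g.

Definition mor_id (X : ringed_space) : raw_morphism X X :=
  @RawMorphism X X id (fun=> id).

Definition mor_comp (X Y Z : ringed_space)
    (g : raw_morphism Y Z) (f : raw_morphism X Y) : raw_morphism X Z :=
  @RawMorphism X Z (g \o f)
    (fun x a => on_stalk (r := f) (on_stalk (r := g) (x := f x) a)).

(* phi identifies the open subspace U of X with the spectrum of A: points of U
   are the primes of A, the basic open sets are the D(a), and the stalk at y is
   the localization of A at the corresponding prime. *)
Definition affine_chart (X : ringed_space) (U : set X) (A : comNzRingType)
    (phi : forall x : X, A -> stalk x) : Prop :=
  let prime_at x := [set a | ~ invertible (phi x a)] in
  open U /\
  [/\ forall x, U x -> ring_hom (phi x) /\ forall a, regular (phi^~ a) x,
      forall x, U x -> prime_ideal (prime_at x),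
      forall P, prime_ideal P ->
        exists x, (U x /\ prime_at x = P) /\
          forall y, U y -> prime_at y = P -> y = x,
      forall x, U x -> forall N : set X, nbhs x N <->
        exists a, invertible (phi x a) /\
          forall y, U y -> invertible (phi y a) -> N y &
      forall x, U x ->
        (forall g : stalk x, exists a s,
          invertible (phi x s) /\ g * phi x s = phi x a) /\
        (forall a, phi x a = 0 -> exists s, invertible (phi x s) /\ s * a = 0)].

Definition is_scheme (X : ringed_space) : Prop :=
  forall x : X, exists (U : set X) (A : comNzRingType)
    (phi : forall x : X, A -> stalk x), U x /\ affine_chart U phi.

Definition flat (X Y : ringed_space) (f : raw_morphism X Y) : Prop :=
  forall x, flat_hom (@on_stalk _ _ f x).

(* Flat, and locally on source and target given by a standard smooth algebra
   (Jacobian criterion). *)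
Definition smooth (X Y : ringed_space) (f : raw_morphism X Y) : Prop :=
  flat f /\ forall x : X,
    exists (U : set X) (A : comNzRingType) (phi : forall x : X, A -> stalk x)
           (V : set Y) (B : comNzRingType) (psi : forall y : Y, B -> stalk y)
           (g : {rmorphism B -> A}),
      [/\ U x /\ affine_chart U phi, affine_chart V psi,
          U `<=` f @^-1` V,
          forall y, U y -> forall b, on_stalk (psi (f y) b) = phi y (g b) &
          standard_smooth g].

Definition open_immersion (X Y : ringed_space) (f : raw_morphism X Y) : Prop :=
  [/\ morphism f, injective f, forall W, open W -> open (f @` W) &
      forall x, bijective (@on_stalk _ _ f x)].

(* f is the closed immersion defined by the ideal generated by p. *)
Definition reduction_mod (p : nat) (X Y : ringed_space)
    (f : raw_morphism X Y) : Prop :=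
  [/\ morphism f, injective f,
      forall x (N : set X), nbhs x N ->
        exists M : set Y, nbhs (f x) M /\ f @^-1` M `<=` N,
      range f = [set y | ~ invertible (p%:R : stalk y)] &
      forall x, (forall a : stalk x, exists b, on_stalk (r := f) b = a) /\
        (forall b, on_stalk (r := f) (x := x) b = 0 <-> exists c, b = c *+ p)].

(* X is a scheme over Z/p^2 and is flat over it. *)
Definition flat_over_Zp2 (p : nat) (X : ringed_space) : Prop :=
  forall x : X, (p ^ 2)%:R = 0 :> stalk x /\
    flat_hom (fun n : 'Z_(p ^ 2) => (n : nat)%:R : stalk x).

(* The universal property is required among all locally ringed spaces: a fibre
   product of schemes has it. *)
Definition is_fiber_product (X Y Z P : ringed_space)
    (f : raw_morphism X Z) (g : raw_morphism Y Z)
    (p1 : raw_morphism P X) (p2 : raw_morphism P Y) : Prop :=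
  [/\ is_scheme P, morphism p1, morphism p2,
      eq_mor (mor_comp f p1) (mor_comp g p2) &
      forall (Q : ringed_space) (q1 : raw_morphism Q X) (q2 : raw_morphism Q Y),
        locally_ringed Q -> morphism q1 -> morphism q2 ->
        eq_mor (mor_comp f q1) (mor_comp g q2) ->
        let factors u := [/\ morphism u, eq_mor (mor_comp p1 u) q1 &
                             eq_mor (mor_comp p2 u) q2] in
        (exists u, factors u) /\
        (forall u u', factors u -> factors u' -> eq_mor u u')].

(* The absolute Frobenius of a space on which p = 0. *)
Definition frobenius (p : nat) (X : ringed_space) : raw_morphism X X :=
  @RawMorphism X X id (fun _ a => a ^+ p).

(** * Differentials *)

(* The sheaf of relative differentials of f : X -> Y; its stalk at x is the
   module of differentials of the local ring at x over the one at f x. *)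
Record differentials (X Y : ringed_space) (f : raw_morphism X Y) :=
  Differentials {
    omega :> module_sheaf X;
    diff : forall x, stalk x -> omega x;
    diff_kahler : forall x, is_kahler (@on_stalk _ _ f x) (@diff x);
    diff_regular : forall s x, regular s x ->
      mregular (fun y => diff (s y)) x }.

(* The pullback w |-> f^* w of differentials: the map with f^*(da) = d(f^* a),
   semilinear over the pullback of functions. *)
Definition diff_pull (X X' Y Y' : ringed_space) (g : raw_morphism X Y)
    (g' : raw_morphism X' Y') (Om : differentials g) (Om' : differentials g')
    (f : raw_morphism X X') (x : X) (w : Om' (f x)) : Om x :=
  xget 0 [set v | exists th : Om' (f x) -> Om x,
    [/\ semilinear (@on_stalk _ _ f x) th,
        forall a, th (diff Om' a) = diff Om (on_stalk a) & v = th w]].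

(** * The lifting of X' and the lifting of U *)

Record lifted_frobenius_twist (p : nat) := LiftedFrobeniusTwist {
  S_ : ringed_space;
  X_ : ringed_space;
  X'_ : ringed_space;
  tS : ringed_space;
  tX' : ringed_space;
  XS : raw_morphism X_ S_;
  X'S : raw_morphism X'_ S_;
  X'X : raw_morphism X'_ X_;
  relF : raw_morphism X_ X'_;
  inS : raw_morphism S_ tS;
  inX' : raw_morphism X'_ tX';
  tX'S : raw_morphism tX' tS;
  schemes : [/\ is_scheme S_, is_scheme X_, is_scheme tS & is_scheme tX'];
  char_p : forall s : S_, p%:R = 0 :> stalk s;
  XS_mor : morphism XS;
  XS_smooth : smooth XS;
  X'_product : is_fiber_product XS (frobenius p S_) X'X X'S;
  relF_mor : morphism relF;
  relF_X : eq_mor (mor_comp X'X relF) (frobenius p X_);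
  relF_S : eq_mor (mor_comp X'S relF) XS;
  tS_flat : flat_over_Zp2 p tS;
  inS_red : reduction_mod p inS;
  tX'S_mor : morphism tX'S;
  tX'S_flat : flat tX'S;
  inX'_red : reduction_mod p inX';
  inX'_S : eq_mor (mor_comp tX'S inX') (mor_comp inS X'S) }.

(* An open subset U of X and a smooth lifting of U. *)
Record lifted_open (p : nat) (D : lifted_frobenius_twist p) := LiftedOpen {
  U_ : ringed_space;
  tU : ringed_space;
  UX : raw_morphism U_ (X_ D);
  inU : raw_morphism U_ tU;
  tUS : raw_morphism tU (tS D);
  U_scheme : is_scheme U_;
  tU_scheme : is_scheme tU;
  UX_open : open_immersion UX;
  tUS_mor : morphism tUS;
  tUS_smooth : smooth tUS;
  inU_red : reduction_mod p inU;
  inU_S : eq_mor (mor_comp tUS inU) (mor_comp (inS D) (mor_comp (XS D) UX)) }.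

Section Open.
Variables (p : nat) (D : lifted_frobenius_twist p) (L : lifted_open D).

Definition US : raw_morphism (U_ L) (S_ D) := mor_comp (XS D) (UX L).

(* The restriction of the relative Frobenius to U. *)
Definition relFU : raw_morphism (U_ L) (X'_ D) := mor_comp (relF D) (UX L).

(* tP is the product of tU with itself over tS, tT the first infinitesimal
   neighbourhood of its diagonal (the closed subspace of an open subspace with
   the points of the diagonal, defined by the square of the ideal I of the
   diagonal), and T the reduction of tT. *)
Record diagonal_neighborhood := DiagonalNeighborhood {
  tP : ringed_space;
  tT : ringed_space;
  T_ : ringed_space;
  pr1 : raw_morphism tP (tU L);
  pr2 : raw_morphism tP (tU L);
  tdelta : raw_morphism (tU L) tT;
  tTP : raw_morphism tT tP;
  inT : raw_morphism T_ tT;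
  h1 : raw_morphism T_ (U_ L);
  h2 : raw_morphism T_ (U_ L);
  tP_product : is_fiber_product (tUS L) (tUS L) pr1 pr2;
  tT_scheme : is_scheme tT;
  T_scheme : is_scheme T_;
  tdelta_mor : morphism tdelta;
  tTP_mor : morphism tTP;
  tdelta_bij : bijective tdelta;
  tdelta_open : forall W, open W -> open (tdelta @` W);
  diagonal1 : eq_mor (mor_comp pr1 (mor_comp tTP tdelta)) (mor_id (tU L));
  diagonal2 : eq_mor (mor_comp pr2 (mor_comp tTP tdelta)) (mor_id (tU L));
  tTP_ideal : forall x : tU L,
    let I := [set a | on_stalk (r := mor_comp tTP tdelta) (x := x) a = 0] in
    (forall b : stalk (tdelta x), exists a, on_stalk (r := tTP) a = b) /\
    [set a | on_stalk (r := tTP) (x := tdelta x) a = 0] = ideal_square I;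
  inT_red : reduction_mod p inT;
  h1_mor : morphism h1;
  h2_mor : morphism h2;
  h1_red : eq_mor (mor_comp (inU L) h1) (mor_comp (mor_comp pr1 tTP) inT);
  h2_red : eq_mor (mor_comp (inU L) h2) (mor_comp (mor_comp pr2 tTP) inT) }.

Definition th1 (N : diagonal_neighborhood) : raw_morphism (tT N) (tU L) :=
  mor_comp (pr1 N) (tTP N).
Definition th2 (N : diagonal_neighborhood) : raw_morphism (tT N) (tU L) :=
  mor_comp (pr2 N) (tTP N).

End Open.

(** * The torsor of liftings and its affine functions *)

(* A lifted space [Y] in [tY], and a morphism [phi] from Y to X' whose liftings
   from tY to tX' are to be considered. *)
Record lifting_problem (p : nat) (D : lifted_frobenius_twist p) :=
  LiftingProblem {
    Y_ : ringed_space;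
    tY : ringed_space;
    inY : raw_morphism Y_ tY;
    tYS : raw_morphism tY (tS D);
    phi : raw_morphism Y_ (X'_ D) }.

Section Torsor.
Variables (p : nat) (D : lifted_frobenius_twist p).
Variable Om : differentials (X'S D).
Variable Q : lifting_problem D.

(* G is a section over W of the torsor: a tS-morphism W -> tX' lifting phi. *)
Definition lifting (W : set (tY Q)) (G : raw_morphism (tY Q) (tX' D)) : Prop :=
  [/\ open W, morphism_on W G, eq_mor_on W (mor_comp (tX'S D) G) (tYS Q) &
      eq_mor_on (inY Q @^-1` W) (mor_comp G (inY Q)) (mor_comp (inX' D) (phi Q))].

(* A family of maps from the stalks of Om to those of the functions on Y. *)
Definition field_family := forall y : Y_ Q, Om (phi Q y) -> stalk y.

(* xi is a section over W of phi^* T_{X'/S}, i.e. a linear map from Om to the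
   direct image of the functions on Y. *)
Definition tangent_field (W : set (tY Q)) (xi : field_family) : Prop :=
  forall y, W (inY Q y) ->
    semilinear_form (@on_stalk _ _ (phi Q) y) (@xi y) /\
    forall w, mregular w (phi Q y) -> regular (fun z => xi z (w (phi Q z))) y.

(* xi = G2 - G1 on W.  The family [a] serves to evaluate one and the same germ
   at the provably equal points G1, G2 and inX' \o phi. *)
Definition lifting_difference (W : set (tY Q))
    (G1 G2 : raw_morphism (tY Q) (tX' D)) (xi : field_family) : Prop :=
  tangent_field W xi /\
  forall y, W (inY Q y) -> forall a : forall z : tX' D, stalk z,
    on_stalk (r := G2) (a (G2 (inY Q y))) - on_stalk (r := G1) (a (G1 (inY Q y)))
    = times_p p (@on_stalk _ _ (inY Q) y)
        (xi y (diff Om (on_stalk (a (inX' D (phi Q y)))))).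

(* The list of the (a_i, w_i) represents the element of the stalk at y of
   phi^* Om which is the sum of the a_i (x) w_i; as before, w_i only matters
   through its value at phi y. *)
Definition pull_germ (y : Y_ Q) : Type :=
  seq (stalk y * (forall z : X'_ D, Om z)).

Definition pairing (y : Y_ Q) (w : pull_germ y) (xi : Om (phi Q y) -> stalk y) :
    stalk y :=
  \sum_(c <- w) c.1 * xi (c.2 (phi Q y)).

(* Equality in the tensor product. *)
Definition pull_eq (y : Y_ Q) (w w' : pull_germ y) : Prop :=
  forall (N : lmodType (stalk y)) (g : Om (phi Q y) -> N),
    semilinear (@on_stalk _ _ (phi Q) y) g ->
    \sum_(c <- w) c.1 *: g (c.2 (phi Q y))
    = \sum_(c <- w') c.1 *: g (c.2 (phi Q y)).

Definition pull_regular (w : forall y, pull_germ y) (y : Y_ Q) : Prop :=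
  exists r : seq ((forall z : Y_ Q, stalk z) * (forall z : X'_ D, Om z)),
    (forall i, (i < size r)%N ->
      let c := nth (fun=> 0, fun=> 0) r i in
      regular c.1 y /\ mregular c.2 (phi Q y)) /\
    \forall z \near y, pull_eq (w z) [seq (c.1 z, c.2) | c <- r].

(* The section 1 (x) w of phi^* Om. *)
Definition one_tensor (w : forall z : X'_ D, Om z) (y : Y_ Q) : pull_germ y :=
  [:: (1, w)].

(* A function on the torsor, together with its linear part, i.e. its image
   under the projection from affine functions to phi^* Om. *)
Record torsor_function := TorsorFunction {
  value : raw_morphism (tY Q) (tX' D) -> forall y : Y_ Q, stalk y;
  linear_part : forall y : Y_ Q, pull_germ y }.

(* e is a section over V of the sheaf E of affine functions on the torsor. *)
Definition affine_function (V : set (Y_ Q)) (e : torsor_function) : Prop :=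
  [/\ forall y, V y -> pull_regular (linear_part e) y,
      forall W G, lifting W G -> forall y, V y -> W (inY Q y) ->
        regular (value e G) y,
      forall W G G', lifting W G -> lifting W G' -> eq_mor_on W G G' ->
        forall y, V y -> W (inY Q y) -> value e G y = value e G' y &
      forall W G1 G2 xi, lifting W G1 -> lifting W G2 ->
        lifting_difference W G1 G2 xi -> forall y, V y -> W (inY Q y) ->
        value e G2 y = value e G1 y + pairing (linear_part e y) (@xi y)].

Definition torsor_function_eq (V : set (Y_ Q)) (e e' : torsor_function) : Prop :=
  (forall W G, lifting W G -> forall y, V y -> W (inY Q y) ->
     value e G y = value e' G y) /\
  (forall y, V y -> pull_eq (linear_part e y) (linear_part e' y)).

(* The inclusion of functions on Y, as constant functions on the torsor. *)
Definition constant_function (b : forall y : Y_ Q, stalk y) : torsor_function :=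
  TorsorFunction (fun=> b) (fun=> [::]).

Definition torsor_function_sub (e e' : torsor_function) : torsor_function :=
  TorsorFunction (fun G y => value e G y - value e' G y)
    (fun y => linear_part e y ++ [seq (- c.1, c.2) | c <- linear_part e' y]).

(* The splitting defined by the lifting F: w |-> (G |-> <w, G - F>). *)
Definition splitting (F : raw_morphism (tY Q) (tX' D))
    (w : forall y, pull_germ y) : torsor_function :=
  TorsorFunction
    (fun G y => xget 0 [set v | exists W xi,
       [/\ W (inY Q y), lifting W F, lifting W G,
           lifting_difference W F G xi & v = pairing (w y) (@xi y)]])
    w.

End Torsor.

(** * The connection *)

Section Connection.
Variables (p : nat) (D : lifted_frobenius_twist p) (L : lifted_open D).
Variables (N : diagonal_neighborhood L) (Om : differentials (X'S D)).

Definition liftings_U : lifting_problem D :=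
  LiftingProblem (inU L) (tUS L) (relFU L).

(* Here h1 and h2 have the same composite with the relative Frobenius, so that
   one may as well use h2. *)
Definition liftings_T : lifting_problem D :=
  LiftingProblem (inT N) (mor_comp (tUS L) (th1 N)) (mor_comp (relFU L) (h1 N)).

(* The pullback of an affine function e by h (one of h1, h2), as an affine
   function on the torsor of liftings to tT; th is the lifting of h and
   h^* of the torsor is identified with the latter by G0 |-> G0 \o th:
     (h^* e)(G) = h^*(e(G0)) + <h^*(linear part of e), G - G0 \o th>
   for any local G0. *)
Definition torsor_function_pull (h : raw_morphism (T_ N) (U_ L))
    (th : raw_morphism (tT N) (tU L)) (e : torsor_function Om liftings_U) :
    torsor_function Om liftings_T :=
  let lin (t : T_ N) : pull_germ Om (Q := liftings_T) t :=
    [seq (on_stalk (r := h) c.1, c.2) | c <- linear_part e (h t)] in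
  TorsorFunction (Q := liftings_T)
    (fun G (t : T_ N) => xget 0 [set v : stalk t |
       exists (W0 : set (tU L)) (G0 : raw_morphism (tU L) (tX' D))
              (W : set (tT N)) (xi : field_family Om liftings_T),
       [/\ lifting (Q := liftings_U) W0 G0,
           W (inT N t) /\ W `<=` th @^-1` W0,
           lifting (Q := liftings_T) W G,
           lifting_difference (Q := liftings_T) W (mor_comp G0 th) G xi &
           v = on_stalk (r := h) (value e G0 (h t)) + pairing (lin t) (@xi t)]])
    lin.

(* nabla e = h2^* e - h1^* e, a section of h1^* E = O_T (x) E.  It belongs to the
   submodule Om_{U/S} (x) E, inside which Om_{U/S} = Om_{U/S} (x) O consists of the
   constant functions with values in Om_{U/S}, itself contained in O_T by
   [differential_in_T] below. *)
Definition nabla (e : torsor_function Om liftings_U) :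
    torsor_function Om liftings_T :=
  torsor_function_sub (torsor_function_pull (h2 N) (th2 N) e)
                      (torsor_function_pull (h1 N) (th1 N) e).

Variable OmU : differentials (US L).

(* The inclusion of the differentials of U/S in the functions on T: it is
   linear for the structure given by h1 and maps da to h2^* a - h1^* a. *)
Definition differential_in_T (t : T_ N) (w : OmU (h1 N t)) : stalk t :=
  xget 0 [set v | exists th : OmU (h1 N t) -> stalk t,
    [/\ semilinear_form (@on_stalk _ _ (h1 N) t) th,
        forall a : forall u : U_ L, stalk u,
          th (diff OmU (a (h1 N t)))
          = on_stalk (r := h2 N) (a (h2 N t)) - on_stalk (r := h1 N) (a (h1 N t)) &
        v = th w]].

Variables (OmtX' : differentials (tX'S D)) (OmtU : differentials (tUS L)).

(* zeta is the map from Om to the direct image of OmU such that dF is the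
   composite of reduction modulo p, zeta and [p]. *)
Definition is_divided_differential (F : raw_morphism (tU L) (tX' D))
    (zeta : forall u : U_ L, Om (relFU L u) -> OmU u) : Prop :=
  forall u : U_ L,
    [/\ semilinear (@on_stalk _ _ (relFU L) u) (@zeta u),
        forall w, mregular w (relFU L u) ->
          mregular (fun v => zeta v (w (relFU L v))) u &
        forall w : forall z : tX' D, OmtX' z,
          diff_pull OmtU (w (F (inU L u)))
          = times_p p (@diff_pull _ _ _ _ _ _ OmU OmtU (inU L) u)
              (zeta u (diff_pull Om (w (inX' D (relFU L u)))))].

End Connection.

(* Main.v *)
(* Write [p] for the injections induced by multiplication by p.  If xi_i is the
   difference G - F \o th_i on the torsor of liftings to tT, then
   nabla(sigma_F(w)) takes the value xi_2(w) - xi_1(w) at G, which is minus the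
   difference F \o th_2 - F \o th_1 evaluated at w.  On w = da' this difference
   is characterized by its image under [p], namely
   th_2^*(F^* a) - th_1^*(F^* a), the image of d(F^* a) = [p] zeta(da') under the
   inclusion of the differentials of tU in the functions on tT.

   All of this needs [p] to be injective, i.e. tU and tT to be flat over Z/p^2.
   For tT this rests on two facts: the differentials of tU over tS are locally
   free (Jacobian criterion), and they are identified with I / I^2, where I is
   the ideal of the diagonal.  The latter follows from the universal property of
   the product tU x tU tested on one-point spaces whose ring is a ring of dual
   numbers. *)
From HB Require Import structures.
From mathcomp Require Import all_boot all_algebra.
From mathcomp Require Import boolp classical_sets topology.
From mathcomp Require Import -(notations) mpoly.
From mathcomp Require Import ring.
Require Import Defs.

Set Implicit Arguments.
Unset Strict Implicit.
Unset Printing Implicit Defensive.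
Import GRing.Theory.
Local Open Scope classical_set_scope.
Local Open Scope quotient_scope.
Local Open Scope ring_scope.

(** [times_p], [diff_pull], [splitting], [torsor_function_pull] and [differential_in_T] are values
    picked by [xget], so every computation with them rests on existence and uniqueness of what is
    picked. Uniqueness comes from the universal property of differentials, joined with injectivity
    of [p] where [p] occurs. Existence of a difference of liftings asks for a regular section; the
    algebra is therefore done on stalks, and regularity is proved separately. For tT, dual numbers
    with coefficients in the differentials give a map from I / I^2 back to the differentials. Dual
    numbers with coefficients in O_tT, together with uniqueness, show that going there and back is
    the identity of I / I^2; this is what carries divisibility by p from the differentials to O_tT.
    Stalks depend on points that are often equal only by proof. Germs are compared as values of
    families, and the remaining transports are confined to a few lemmas. *)

(** * Additive maps and ring homomorphisms given as predicates *)

Section ZmodMorphism.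
Variables (U V : zmodType) (f : U -> V) (hf : zmod_morphism f).
Let g : {additive U -> V} := HB.pack f (GRing.isZmodMorphism.Build U V f hf).

Lemma zmod_morphism0 : f 0 = 0. Proof. exact: (raddf0 g). Qed.
Lemma zmod_morphismD x y : f (x + y) = f x + f y.
Proof. exact: (raddfD g). Qed.
Lemma zmod_morphismMn x n : f (x *+ n) = f x *+ n.
Proof. exact: (raddfMn g). Qed.
Lemma zmod_morphism_sum I (r : seq I) (P : pred I) (F : I -> U) :
  f (\sum_(i <- r | P i) F i) = \sum_(i <- r | P i) f (F i).
Proof. exact: (raddf_sum g). Qed.
End ZmodMorphism.

Section RingHom.
Variables (A B : pzRingType) (f : A -> B) (hf : ring_hom f).

Lemma ring_homB : zmod_morphism f. Proof. exact: hf.1. Qed.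
Lemma ring_hom0 : f 0 = 0. Proof. exact: zmod_morphism0 hf.1. Qed.
Lemma ring_homD x y : f (x + y) = f x + f y.
Proof. exact: zmod_morphismD hf.1 _ _. Qed.
Lemma ring_homMn x n : f (x *+ n) = f x *+ n.
Proof. exact: zmod_morphismMn hf.1 _ _. Qed.
Lemma ring_hom1 : f 1 = 1. Proof. by case: hf => _ []. Qed.
Lemma ring_homM x y : f (x * y) = f x * f y. Proof. by case: hf => _ []. Qed.
Lemma ring_homX x n : f (x ^+ n) = f x ^+ n.
Proof.
by elim: n => [|n IH]; rewrite ?expr0 ?ring_hom1 // !exprS ring_homM IH.
Qed.
Lemma ring_hom_nat n : f n%:R = n%:R.
Proof. by rewrite ring_homMn ring_hom1. Qed.
End RingHom.

Lemma ring_hom_comp (A B C : pzRingType) (f : A -> B) (g : B -> C) :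
  ring_hom f -> ring_hom g -> ring_hom (g \o f).
Proof.
move=> hf hg; split; first by move=> x y /=; rewrite hf.1 hg.1.
split; first by rewrite /= (ring_hom1 hf) (ring_hom1 hg).
by move=> x y; rewrite /= (ring_homM hf) (ring_homM hg).
Qed.

Lemma invertible_hom (A B : comPzRingType) (f : A -> B) a :
  ring_hom f -> invertible a -> invertible (f a).
Proof.
by move=> hf [b ab]; exists (f b); rewrite -(ring_homM hf) ab (ring_hom1 hf).
Qed.

(** * Flatness and annihilators *)

Section PrincipalQuotient.
Variables (A : comPzRingType) (y : A).

Definition multiple : {pred A} := fun a => `[< exists c, a = y * c >].

Lemma multipleP a : reflect (exists c, a = y * c) (a \in multiple).
Proof. exact: asboolP. Qed.

Fact multiple_zmod_closed : zmod_closed multiple.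
Proof.
split; first by apply/multipleP; exists 0; rewrite mulr0.
move=> _ _ /multipleP[c ->] /multipleP[d ->].
by apply/multipleP; exists (c - d); rewrite mulrBr.
Qed.
HB.instance Definition _ := GRing.isZmodClosed.Build A multiple
  multiple_zmod_closed.

Definition principal_quotient := Quotient.quot multiple.
HB.instance Definition _ := GRing.Zmodule.on principal_quotient.

Definition class (a : A) : principal_quotient := \pi a.

Lemma class_eq a b : class a = class b <-> exists c, a = b + y * c.
Proof.
rewrite /class; split.
  move/eqP; rewrite -Quotient.idealrBE => /multipleP[c e]; exists c.
  by rewrite -e addrC subrK.
case=> c ->; apply/eqP; rewrite -Quotient.idealrBE; apply/multipleP; exists c.
by rewrite addrC addKr.
Qed.

Lemma classB : zmod_morphism class.
Proof. by move=> a b; rewrite /class; exact: raddfB. Qed.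

Lemma class_surj (q : principal_quotient) : exists a, q = class a.
Proof. by exists (repr q); rewrite /class reprK. Qed.

Definition quotient_scale (a : A) (q : principal_quotient) :=
  class (a * repr q).

Lemma quotient_scaleE a b : quotient_scale a (class b) = class (a * b).
Proof.
apply/class_eq; have /class_eq[c ->] : class (repr (class b)) = class b.
  by rewrite /class reprK.
by exists (a * c); rewrite mulrDr mulrCA.
Qed.

Fact quotient_scalerA a b v :
  quotient_scale a (quotient_scale b v) = quotient_scale (a * b) v.
Proof. by have [c ->] := class_surj v; rewrite !quotient_scaleE mulrA. Qed.
Fact quotient_scale1r : left_id 1 quotient_scale.
Proof. by move=> v; have [c ->] := class_surj v; rewrite quotient_scaleE mul1r. Qed.
Fact quotient_scalerDr : right_distributive quotient_scale +%R.
Proof.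
move=> a u v; have [b ->] := class_surj u; have [c ->] := class_surj v.
rewrite -(zmod_morphismD classB) !quotient_scaleE mulrDr.
by rewrite (zmod_morphismD classB).
Qed.
Fact quotient_scalerDl v : {morph quotient_scale^~ v : a b / a + b}.
Proof.
move=> a b; have [c ->] := class_surj v.
by rewrite !quotient_scaleE mulrDl (zmod_morphismD classB).
Qed.
HB.instance Definition _ := GRing.Zmodule_isLmodule.Build A principal_quotient
  quotient_scalerA quotient_scale1r quotient_scalerDr quotient_scalerDl.

Lemma class_scale a b : a *: class b = class (a * b).
Proof. exact: quotient_scaleE. Qed.

End PrincipalQuotient.

(** The hypothesis says that multiplication by [x] embeds A/yA into A. Tensored with B it becomes
    multiplication by [f x] from B/f(y)B to B, which flatness keeps injective. As [flat_hom] speaks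
    of all tensor products, the explicit models [t1] and [t2] may be used. *)
Lemma flat_annihilator (A B : comPzRingType) (f : A -> B) (x y : A) :
  ring_hom f -> flat_hom f ->
  (forall a, x * a = 0 <-> exists c, a = y * c) ->
  forall b, f x * b = 0 -> exists c, b = f y * c.
Proof.
move=> hf fl ann b fxb.
pose M := principal_quotient y; pose T1 := principal_quotient (f y).
pose g (m : M) : A^o := x * repr m.
have gE a : g (class y a) = x * a.
  rewrite /g; have /class_eq[c ->] : class y (repr (class y a)) = class y a.
    by rewrite /class reprK.
  rewrite mulrDr; have -> : x * (y * c) = 0 by apply/ann; exists c.
  by rewrite addr0.
have g_lin : semilinear id g.
  split=> [m m'|a m].
    have [c ->] := class_surj m; have [c' ->] := class_surj m'.
    by rewrite -(classB y) !gE mulrBr.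
  by have [c ->] := class_surj m; rewrite class_scale !gE mulrCA.
have g_inj : injective g.
  move=> m m'; have [c ->] := class_surj m; have [c' ->] := class_surj m'.
  rewrite !gE => e; apply/class_eq.
  have /ann[d e'] : x * (c - c') = 0 by rewrite mulrBr e subrr.
  by exists d; rewrite -e' addrC subrK.
pose t1 (b : B) (m : M) : T1 := class (f y) (b * f (repr m)).
have t1E b' a : t1 b' (class y a) = class (f y) (b' * f a).
  rewrite /t1; apply/class_eq.
  have /class_eq[c ->] : class y (repr (class y a)) = class y a.
    by rewrite /class reprK.
  exists (b' * f c).
  by rewrite (ring_homD hf) (ring_homM hf) mulrDr (mulrCA _ (f y)).
pose t2 (b : B) (a : A^o) : B := b * f a.
have t1_tensor : is_tensor f t1.
  split.
    split=> [m|b'|b' a m].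
    - have [c ->] := class_surj m => u v /=.
      by rewrite !t1E mulrBl classB.
    - move=> m m'; have [c ->] := class_surj m; have [c' ->] := class_surj m'.
      by rewrite -(classB y) !t1E (ring_homB hf) mulrBr (classB (f y)).
    - have [c ->] := class_surj m.
      by rewrite class_scale !t1E (ring_homM hf) mulrA.
  move=> T' t' [b1 b2 b3].
  pose u (q : T1) : T' := t' (repr q) (class y 1).
  have uE b' : u (class (f y) b') = t' b' (class y 1).
    rewrite /u; have /class_eq[c ->] :
        class (f y) (repr (class (f y) b')) = class (f y) b'.
      by rewrite /class reprK.
    rewrite (zmod_morphismD (b1 _)) (mulrC (f y)) b3 class_scale mulr1.
    have -> : class y y = class y 0.
      by apply/class_eq; exists 1; rewrite mulr1 add0r.
    by rewrite (zmod_morphism0 (classB y)) (zmod_morphism0 (b2 _)) addr0.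
  exists u; split.
    split.
      move=> q q'; have [c ->] := class_surj q; have [c' ->] := class_surj q'.
      by rewrite -(classB (f y)) !uE b1.
    move=> b' m; have [c ->] := class_surj m.
    by rewrite t1E uE b3 class_scale mulr1.
  move=> u' [u'B u'E]; apply/funext => q; have [c ->] := class_surj q.
  by rewrite uE -u'E t1E (ring_hom1 hf) mulr1.
have t2_tensor : is_tensor f t2.
  split.
    split=> [m u v|b' u v|b' a m]; rewrite /t2 /=.
    - by rewrite mulrBl.
    - by rewrite (ring_homB hf) mulrBr.
    - by rewrite -mulrA -(ring_homM hf).
  move=> T' t' [b1 b2 b3]; exists (fun b => t' b 1); split.
    split; first exact: b1.
    by move=> b' m; rewrite /t2 b3; congr t'; rewrite -[RHS]mulr1.
  move=> u' [u'B u'E]; apply/funext => b'.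
  by rewrite -u'E /t2 (ring_hom1 hf) mulr1.
pose u (q : T1) : B := repr q * f x.
have fyx : f y * f x = 0.
  rewrite mulrC -(ring_homM hf) (_ : x * y = 0) ?(ring_hom0 hf) //.
  by apply/ann; exists 1; rewrite mulr1.
have uE b' : u (class (f y) b') = b' * f x.
  rewrite /u; have /class_eq[c ->] :
      class (f y) (repr (class (f y) b')) = class (f y) b'.
    by rewrite /class reprK.
  by rewrite mulrDl mulrAC fyx mul0r addr0.
have uB : zmod_morphism u.
  move=> q q'; have [c ->] := class_surj q; have [c' ->] := class_surj q'.
  by rewrite -(classB (f y)) !uE mulrBl.
have u12 b' m : u (t1 b' m) = t2 b' (g m).
  have [c ->] := class_surj m.
  by rewrite t1E uE gE /t2 (ring_homM hf) -mulrA (mulrC (f c)).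
have /class_eq[c ->] : class (f y) b = class (f y) 0; last first.
  by exists c; rewrite add0r.
apply: (fl _ _ g g_lin g_inj _ _ t1 t2 t1_tensor t2_tensor u uB u12).
by rewrite !uE mul0r mulrC.
Qed.

(* For a Z/p^2-module, this is flatness over Z/p^2. *)
Definition p_torsion_multiple (p : nat) (V : zmodType) : Prop :=
  forall v : V, v *+ p = 0 -> exists v', v = v' *+ p.

(** Over A the annihilator of p is exactly pA, so [flat_annihilator] applies with both elements
    equal to p. *)
Lemma flat_torsion p (A B : comPzRingType) (f : A -> B) :
  ring_hom f -> flat_hom f -> (p ^ 2)%:R = 0 :> A ->
  p_torsion_multiple p A -> p_torsion_multiple p B.
Proof.
move=> hf fl p2 tA b pb.
have ann (a : A) : p%:R * a = 0 <-> exists c, a = p%:R * c.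
  split; first by rewrite mulr_natl => /tA[c ->]; exists c; rewrite mulr_natl.
  by case=> c ->; rewrite mulrA -natrM mulnn p2 mul0r.
have [|c ->] := flat_annihilator hf fl ann (b := b).
  by rewrite (ring_hom_nat hf) mulr_natl.
by exists c; rewrite (ring_hom_nat hf) mulr_natl.
Qed.

Lemma Zp2_torsion (p : nat) (A : comPzRingType) : prime p ->
  (p ^ 2)%:R = 0 :> A ->
  flat_hom (fun n : 'Z_(p ^ 2) => (n : nat)%:R : A) -> p_torsion_multiple p A.
Proof.
move=> pp p2 fl.
have p2gt : (1 < p ^ 2)%N by rewrite (ltn_exp2l 0) // prime_gt1.
(* ['Z_(p ^ 2)] computes modulo [(Zp_trunc (p ^ 2)).+2], which is p^2 because p^2 > 1. *)
have e2 : (Zp_trunc (p ^ 2)).+2 = (p ^ 2)%N by apply: Zp_cast.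
have modE n : (n %% (Zp_trunc (p ^ 2)).+2)%:R = n%:R :> A.
  by rewrite e2 {2}(divn_eq n (p ^ 2)) natrD natrM p2 mulr0 add0r.
apply: (flat_torsion _ fl).
- split.
    move=> m n /=; rewrite modE natrD modE natrB; last exact: ltnW.
    have -> : (Zp_trunc (p ^ 2)).+2%:R = 0 :> A by rewrite e2.
    by rewrite sub0r.
  by split=> //= m n; rewrite modE natrM.
- by rewrite -[RHS](char_Zp p2gt).
- move=> v pv; have : (p * p %| v * p)%N.
    have /(congr1 val) : v * p%:R = 0 by rewrite mulr_natr.
    rewrite /= Zp_nat /= modnMmr => e.
    have dvdE n : (p * p %| n)%N = ((Zp_trunc (p ^ 2)).+2 %| n)%N by rewrite e2 mulnn.
    by rewrite dvdE /dvdn e.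
  rewrite dvdn_pmul2r ?prime_gt0 // => /dvdnP[k ek].
  by exists k%:R; rewrite -mulrnA -ek natr_Zp.
Qed.

(** * Kahler differentials *)

Section Submodule.
Variables (B : comPzRingType) (M : lmodType B) (P : M -> Prop).

Definition submodule : Prop :=
  [/\ P 0, forall x y, P x -> P y -> P (x + y) & forall a x, P x -> P (a *: x)].

Hypothesis hP : submodule.

(** The proof of closure is an argument so that the module structure can be inferred from the
    predicate alone. *)
Definition submodule_pred of submodule : {pred M} := fun x => `[< P x >].

Fact submodule_pred_closed : GRing.submod_closed (submodule_pred hP).
Proof.
case: (hP) => P0 PD PZ; split; first exact/asboolP.
move=> a u v /asboolP Pu /asboolP Pv; apply/asboolP.
by apply: PD => //; apply: PZ.
Qed.
HB.instance Definition _ := GRing.isSubmodClosed.Build B M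
  (submodule_pred hP) (GRing.submod_closed_semi submodule_pred_closed).

Definition submodule_type := {x : M | x \in submodule_pred hP}.
HB.instance Definition _ := SubChoice.on submodule_type.
HB.instance Definition _ := [SubChoice_isSubLmodule of submodule_type by <:].

End Submodule.

Section RestrictionOfScalars.
Variables (A B : comPzRingType) (f : A -> B).

(** The type carries the homomorphism in its last argument, from which the scalar action is
    inferred. *)
Definition restriction (M : lmodType B) of ring_hom f : Type := M.

Variables (M : lmodType B) (hf : ring_hom f).
HB.instance Definition _ := GRing.Zmodule.on (restriction M hf).

Definition restriction_scale (a : A) (m : restriction M hf) :
  restriction M hf := f a *: (m : M).

Fact restriction_scalerA a b v :
  restriction_scale a (restriction_scale b v) = restriction_scale (a * b) v.
Proof. by rewrite /restriction_scale scalerA (ring_homM hf). Qed.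
Fact restriction_scale1r : left_id 1 restriction_scale.
Proof. by move=> v; rewrite /restriction_scale (ring_hom1 hf) scale1r. Qed.
Fact restriction_scalerDr : right_distributive restriction_scale +%R.
Proof. by move=> a u v; rewrite /restriction_scale scalerDr. Qed.
Fact restriction_scalerDl v : {morph restriction_scale^~ v : a b / a + b}.
Proof.
by move=> a b; rewrite /restriction_scale (ring_homD hf) scalerDl.
Qed.
HB.instance Definition _ := GRing.Zmodule_isLmodule.Build A (restriction M hf)
  restriction_scalerA restriction_scale1r restriction_scalerDr
  restriction_scalerDl.

End RestrictionOfScalars.

Section Kahler.
Variables (K A : comPzRingType) (k : K -> A) (Om : lmodType A) (d : A -> Om).
Hypothesis hd : is_kahler k d.

Lemma kahler_diffB : zmod_morphism d. Proof. by case: hd => [[]]. Qed.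
Lemma kahler_diffM a b : d (a * b) = a *: d b + b *: d a.
Proof. by case: hd => [[]]. Qed.
Lemma kahler_diff0 c : d (k c) = 0. Proof. by case: hd => [[]]. Qed.

(** [d] factors through the submodule cut out by [P]. The induced map followed by the inclusion
    agrees with the identity on all [d a], hence everywhere. *)
Lemma kahler_ind (P : Om -> Prop) : submodule P -> (forall a, P (d a)) ->
  forall m, P m.
Proof.
move=> hP Pd m.
have dP a : d a \in submodule_pred hP by apply/asboolP.
pose d' a : submodule_type hP := exist _ (d a) (dP a).
have d'D : derivation k d'.
  split=> [a b|a b|c]; apply/val_inj => /=.
  - exact: kahler_diffB.
  - exact: kahler_diffM.
  - exact: kahler_diff0.
have [g [[[gB gZ] gd] _]] := hd.2 _ _ d'D.
have [id' [_ uniq]] := hd.2 _ _ hd.1.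
have e1 : id' = id by apply: uniq; split.
have e2 : id' = (fun m => val (g m)).
  apply: uniq; split; last by move=> b; rewrite gd.
  by split=> [x y|a x]; rewrite ?gB ?gZ.
have -> : m = val (g m) by rewrite -[LHS](congr1 (@^~ m) e1) e2.
exact/asboolP/(valP (g m)).
Qed.

Lemma kahler_ext (B : comPzRingType) (f : A -> B) (M : lmodType B)
    (g1 g2 : Om -> M) :
  semilinear f g1 -> semilinear f g2 -> (forall a, g1 (d a) = g2 (d a)) ->
  g1 =1 g2.
Proof.
move=> [g1B g1Z] [g2B g2Z] e; apply: kahler_ind => //; split.
- by rewrite (zmod_morphism0 g1B) (zmod_morphism0 g2B).
- by move=> x y ex ey; rewrite (zmod_morphismD g1B) (zmod_morphismD g2B) ex ey.
- by move=> a x ex; rewrite g1Z g2Z ex.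
Qed.

(** The universal property over A, applied to [M] with scalars restricted along [f]. *)
Lemma kahler_lift (B : comPzRingType) (f : A -> B) (M : lmodType B)
    (D : A -> M) :
  ring_hom f -> zmod_morphism D ->
  (forall a b, D (a * b) = f a *: D b + f b *: D a) -> (forall c, D (k c) = 0) ->
  exists g : Om -> M, semilinear f g /\ forall a, g (d a) = D a.
Proof.
move=> hf DB DM D0.
have hD : derivation (M := restriction M hf) k D by split.
by have [g [[[gB gZ] gd] _]] := hd.2 _ _ hD; exists g.
Qed.

Lemma kahler_form_ext (B : comPzRingType) (f : A -> B) (g1 g2 : Om -> B) :
  semilinear_form f g1 -> semilinear_form f g2 ->
  (forall a, g1 (d a) = g2 (d a)) -> g1 =1 g2.
Proof. by move=> h1 h2; apply: (kahler_ext (M := B^o) h1 h2). Qed.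

Lemma kahler_form_lift (B : comPzRingType) (f : A -> B) (D : A -> B) :
  ring_hom f -> zmod_morphism D ->
  (forall a b, D (a * b) = f a * D b + f b * D a) -> (forall c, D (k c) = 0) ->
  exists g : Om -> B, semilinear_form f g /\ forall a, g (d a) = D a.
Proof. by move=> hf DB DM D0; apply: (kahler_lift (M := B^o) hf DB DM D0). Qed.

End Kahler.

Section KahlerMap.
Variables (K A K' A' : comPzRingType) (k : K -> A) (k' : K' -> A').
Variables (Om : lmodType A) (d : A -> Om) (Om' : lmodType A') (d' : A' -> Om').
Hypotheses (hd : is_kahler k d) (hd' : is_kahler k' d').
Variables (f : A -> A') (kf : K -> K').
Hypotheses (hf : ring_hom f) (hk : forall c, f (k c) = k' (kf c)).

Lemma kahler_map : exists th : Om -> Om', semilinear f th /\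
  forall a, th (d a) = d' (f a).
Proof.
apply: (kahler_lift hd) => // [a b|a b|c].
- by rewrite (ring_homB hf) (kahler_diffB hd').
- by rewrite (ring_homM hf) (kahler_diffM hd').
- by rewrite hk (kahler_diff0 hd').
Qed.

Lemma kahler_map_surj (th : Om -> Om') : semilinear f th ->
  (forall a, th (d a) = d' (f a)) -> (forall a', exists a, f a = a') ->
  forall m', exists m, th m = m'.
Proof.
move=> [thB thZ] thd fsurj; apply: (kahler_ind hd'); last first.
  by move=> a'; have [a <-] := fsurj a'; exists (d a).
split; first by exists 0; rewrite (zmod_morphism0 thB).
  by move=> _ _ [x <-] [y <-]; exists (x + y); rewrite (zmod_morphismD thB).
by move=> a' _ [x <-]; have [a <-] := fsurj a'; exists (a *: x); rewrite thZ.
Qed.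

End KahlerMap.

(** * Differentials of a localized standard smooth algebra *)

Lemma mpoly_ring_ind (n : nat) (B : comNzRingType)
    (P : mpoly.mpoly n B -> Prop) :
  (forall b, P (mpoly.mpolyC n b)) ->
  (forall i, P (mpoly.mpolyX B (mpoly.mnm1 i))) ->
  (forall q r, P q -> P r -> P (q + r)) ->
  (forall q r, P q -> P r -> P (q * r)) ->
  forall q, P q.
Proof.
move=> PC PX PD PM; elim/mpoly.mpolyind => [|b m q _ _ Pq].
  by rewrite -(mpoly.mpolyC0 n B); apply: PC.
apply: PD Pq; rewrite -mpoly.mul_mpolyC; apply: (PM); first exact: PC.
have P1 : P 1 by rewrite -(mpoly.mpolyC1 n B); apply: PC.
rewrite mpoly.mpolyXE_id; apply: big_ind => [//|q1 q2|i _]; first exact: PM.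
by elim: (mpoly.fun_of_multinom m i) => [|k IH]; rewrite ?exprS //; apply: PM.
Qed.

Section Derivations.
Variables (B A : comNzRingType) (g : {rmorphism B -> A}).
Variables (R : comPzRingType) (phi : A -> R) (hphi : ring_hom phi).

(** Here [phi] will be a localization map, so that derivations out of the chart and those out of the
    local ring are treated together. *)
Definition derivation_along (M : lmodType R) (E : A -> M) : Prop :=
  [/\ zmod_morphism E, forall a b, E (a * b) = phi a *: E b + phi b *: E a &
      forall b, E (g b) = 0].

Variables (c r : nat) (v : 'I_(c + r) -> A) (f : 'I_c -> mpoly.mpoly (c + r) B).
Let ev := mpoly.mmap g v.

Lemma chain_rule (M : lmodType R) (E : A -> M) : derivation_along E ->
  forall P, E (ev P) = \sum_i phi (ev (mpoly.mderiv i P)) *: E (v i).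
Proof.
move=> [EB EM E0]; apply: mpoly_ring_ind => [b|i|P Q IP IQ|P Q IP IQ].
- rewrite /ev mpoly.mmapC E0 big1 // => i _.
  by rewrite mpoly.mderivC mpoly.mmap0 (ring_hom0 hphi) scale0r.
- rewrite /ev mpoly.mmapX mpoly.mmap1U (bigD1 i) //= big1 ?addr0.
    rewrite mpoly.mderivX mpoly.mnm1E eqxx scale1r.
    have -> : mpoly.mnm_sub (mpoly.mnm1 i) (mpoly.mnm1 i) = mpoly.mnm0.
      by apply/mpoly.mnmP => j; rewrite mpoly.mnmBE mpoly.mnm0E subnn.
    by rewrite mpoly.mmapX mpoly.mmap11 (ring_hom1 hphi) scale1r.
  move=> j ij; rewrite mpoly.mderivX mpoly.mnm1E eq_sym (negbTE ij) scale0r.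
  by rewrite mpoly.mmap0 (ring_hom0 hphi) scale0r.
- rewrite /ev rmorphD /= (zmod_morphismD EB) IP IQ -big_split /=.
  apply: eq_bigr => i _.
  by rewrite mpoly.mderivD mpoly.mmapD (ring_homD hphi) scalerDl.
- rewrite /ev rmorphM /= EM IP IQ !scaler_sumr -big_split /=.
  apply: eq_bigr => i _.
  rewrite mpoly.mderivM rmorphD /= !rmorphM /= (ring_homD hphi).
  by rewrite !(ring_homM hphi) scalerDl !scalerA addrC mulrC.
Qed.

Hypothesis ev_surj : forall a, exists P, ev P = a.
Hypothesis ev_ker : forall P, ev P = 0 <->
  exists q : 'I_c -> mpoly.mpoly (c + r) B, P = \sum_j q j * f j.
Let J := \matrix_(i < c, j < c) ev (mpoly.mderiv (lshift r i) (f j)).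
Hypothesis J_inv : invertible (\det J).

Lemma ev_relation j : ev (f j) = 0.
Proof.
apply/ev_ker; exists (fun i => (i == j)%:R).
by rewrite (bigD1 j) //= eqxx mul1r big1 ?addr0 // => i /negbTE ->; rewrite mul0r.
Qed.

(** Applying [E] to the relations f_j = 0 gives a linear system for the values at the first c
    coordinates, whose matrix is the transposed Jacobian, hence invertible. *)
Lemma derivation_along_eq0 (M : lmodType R) (E : A -> M) : derivation_along E ->
  (forall l, E (v (rshift c l)) = 0) -> forall a, E a = 0.
Proof.
move=> hE El; have [EB EM E0] := hE.
have rel j : \sum_i phi (J i j) *: E (v (lshift r i)) = 0.
  rewrite -[RHS](zmod_morphism0 EB) -(ev_relation j) (chain_rule hE).
  rewrite big_split_ord /= [X in _ = _ + X]big1 ?addr0 => [|l _].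
    by apply: eq_bigr => i _; rewrite mxE.
  by rewrite El scaler0.
have Ec k : E (v (lshift r k)) = 0.
  have [e detJ] := J_inv.
  (* Combining the relations with the k-th column of the adjugate isolates det J times the k-th
     unknown. *)
  have : \sum_j phi (\adj J j k) *: \sum_i phi (J i j) *: E (v (lshift r i)) = 0.
    by rewrite big1 // => j _; rewrite rel scaler0.
  under eq_bigr do rewrite scaler_sumr.
  rewrite exchange_big /= (bigD1 k) //= [X in _ + X]big1 => [|i ik]; last first.
    transitivity (phi (\sum_j J i j * \adj J j k) *: E (v (lshift r i))).
      rewrite (zmod_morphism_sum hphi.1) scaler_suml; apply: eq_bigr => j _.
      by rewrite scalerA (ring_homM hphi) mulrC.
    have := congr1 (fun X : 'M_c => X i k) (mul_mx_adj J).
    rewrite !mxE (negbTE ik) mulr0n => ->.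
    by rewrite (ring_hom0 hphi) scale0r.
  rewrite addr0.
  have -> : \sum_(i < c) phi (\adj J i k) *: (phi (J k i) *: E (v (lshift r k)))
      = phi (\sum_j J k j * \adj J j k) *: E (v (lshift r k)).
    rewrite (zmod_morphism_sum hphi.1) scaler_suml; apply: eq_bigr => j _.
    by rewrite scalerA (ring_homM hphi) mulrC.
  have := congr1 (fun X : 'M_c => X k k) (mul_mx_adj J).
  rewrite !mxE eqxx mulr1n => -> /(congr1 (fun m => phi e *: m)).
  by rewrite scaler0 scalerA -(ring_homM hphi) mulrC detJ (ring_hom1 hphi) scale1r.
move=> a; have [P <-] := ev_surj a.
rewrite (chain_rule hE) big1 // => i _.
by case: (split_ordP i) => j ->; rewrite ?Ec ?El scaler0.
Qed.


(** This is the vector field d/dx_l in the local coordinates given by the last r variables, as in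
    the implicit function theorem. *)
Lemma derivation_dual (l : 'I_r) : exists D : A -> A,
  [/\ zmod_morphism D, forall a b, D (a * b) = a * D b + b * D a,
      forall b, D (g b) = 0 &
      forall l', D (v (rshift c l')) = (l' == l)%:R].
Proof.
have [e detJ] := J_inv.
pose b j := ev (mpoly.mderiv (rshift c l) (f j)).
(* Coefficients of the vector field: on the first c variables they are solved for by Cramer's rule,
   [e] being the inverse of det J, so that every f_j is killed. *)
pose w (i : 'I_(c + r)) : A := match split i with
  | inl k => - \sum_j e * (b j * \adj J j k) | inr l' => (l' == l)%:R end.
have wl k : w (lshift r k) = - \sum_j e * (b j * \adj J j k).
  by rewrite /w (unsplitK (inl k : 'I_c + 'I_r)).
have wr l' : w (rshift c l') = (l' == l)%:R.
  by rewrite /w (unsplitK (inr l' : 'I_c + 'I_r)).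
pose D0 P := \sum_i ev (mpoly.mderiv i P) * w i.
have D0B : zmod_morphism D0.
  move=> P Q; rewrite /D0 -sumrB; apply: eq_bigr => i _.
  by rewrite mpoly.mderivB /ev mpoly.mmapB mulrBl.
have D0M P Q : D0 (P * Q) = ev P * D0 Q + ev Q * D0 P.
  rewrite /D0 !mulr_sumr -big_split; apply: eq_bigr => i _ /=.
  rewrite mpoly.mderivM /ev rmorphD !rmorphM /= mulrDl addrC !mulrA.
  by rewrite (mulrC (mpoly.mmap g v (mpoly.mderiv i P))).
have D0f j : D0 (f j) = 0.
  rewrite /D0 big_split_ord /= [X in _ + X](bigD1 l) //= wr eqxx mulr1.
  rewrite [X in _ + (_ + X)]big1 ?addr0 => [|l' /negbTE l'l]; last first.
    by rewrite wr l'l mulr0.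
  under eq_bigr do rewrite wl mulrN mulr_sumr.
  rewrite sumrN exchange_big /= (bigD1 j) //= [X in - (_ + X)]big1 ?addr0 => [|i ij].
    have -> : \sum_(i < c)
        ev (mpoly.mderiv (lshift r i) (f j)) * (e * (b j * \adj J j i)) =
        e * b j * \sum_i \adj J j i * J i j.
      rewrite mulr_sumr; apply: eq_bigr => i _.
      by rewrite [J i j]mxE; ring.
    have := congr1 (fun X : 'M_c => X j j) (mul_adj_mx J).
    rewrite !mxE eqxx mulr1n => ->.
    by rewrite mulrAC (mulrC e) detJ mul1r addNr.
  have -> : \sum_(i0 < c)
      ev (mpoly.mderiv (lshift r i0) (f j)) * (e * (b i * \adj J i i0)) =
      e * b i * \sum_k \adj J i k * J k j.
    rewrite mulr_sumr; apply: eq_bigr => k _.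
    by rewrite [J k j]mxE; ring.
  have := congr1 (fun X : 'M_c => X i j) (mul_adj_mx J).
  by rewrite !mxE (negbTE ij) mulr0n => ->; rewrite mulr0.
(* [D0] descends from polynomials to A: it kills each f_j, and f_j itself vanishes in A. *)
have D0ker P Q : ev P = ev Q -> D0 P = D0 Q.
  move=> ePQ; apply/eqP; rewrite -subr_eq0 -D0B.
  have /ev_ker[q ->] : ev (P - Q) = 0 by rewrite /ev mpoly.mmapB -/ev ePQ subrr.
  rewrite (zmod_morphism_sum D0B) big1 // => j _.
  by rewrite D0M D0f ev_relation mulr0 mul0r addr0.
have [lift liftK] := choice ev_surj.
exists (fun a => D0 (lift a)); split=> [a a'|a a'|a|l'].
- by rewrite -D0B; apply: D0ker; rewrite /ev mpoly.mmapB -/ev !liftK.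
- transitivity (ev (lift a) * D0 (lift a') + ev (lift a') * D0 (lift a)).
    rewrite -D0M.
    by apply: D0ker; rewrite /ev rmorphM /= -/ev !liftK.
  by rewrite !liftK.
- rewrite (D0ker _ (mpoly.mpolyC (c + r) a)); last first.
    by rewrite liftK /ev mpoly.mmapC.
  by rewrite /D0 big1 // => i _; rewrite mpoly.mderivC /ev mpoly.mmap0 mul0r.
- rewrite (D0ker _ (mpoly.mpolyX B (mpoly.mnm1 (rshift c l')))); last first.
    by rewrite liftK /ev mpoly.mmapX mpoly.mmap1U.
  rewrite /D0 (bigD1 (rshift c l')) //= big1 ?addr0 => [|j lj].
    rewrite mpoly.mderivX mpoly.mnm1E eqxx scale1r.
    have -> : mpoly.mnm_sub (mpoly.mnm1 (rshift c l')) (mpoly.mnm1 (rshift c l'))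
        = mpoly.mnm0.
      by apply/mpoly.mnmP => j; rewrite mpoly.mnmBE mpoly.mnm0E subnn.
    by rewrite /ev mpoly.mmapX mpoly.mmap11 mul1r wr.
  rewrite mpoly.mderivX mpoly.mnm1E eq_sym (negbTE lj) scale0r.
  by rewrite /ev mpoly.mmap0 mul0r.
Qed.

End Derivations.

Section Localization.
Variables (B A : comNzRingType) (K R : comPzRingType).
Variables (g : {rmorphism B -> A}) (psi : B -> K) (phi : A -> R) (k : K -> R).
Hypotheses (hphi : ring_hom phi) (hk : ring_hom k).
Hypothesis k_psi : forall b, k (psi b) = phi (g b).
Hypothesis R_fraction : forall x : R, exists a s,
  invertible (phi s) /\ x * phi s = phi a.
Hypothesis phi_ker : forall a, phi a = 0 ->
  exists s, invertible (phi s) /\ s * a = 0.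
Hypothesis K_fraction : forall x : K, exists b s,
  invertible (psi s) /\ x * psi s = psi b.

Lemma invertible_cancel (C : comPzRingType) (M : lmodType C) (a : C) (x y : M) :
  invertible a -> a *: x = a *: y -> x = y.
Proof.
move=> [b ab] /(congr1 (fun m => b *: m)).
by rewrite !scalerA mulrC ab !scale1r.
Qed.

(** The quotient rule as a relation: [quo x y] holds when x = a/s and D a = y s + x D s. It involves
    no division, and each law of the derivation becomes a polynomial identity. *)
Lemma localize_derivation (D : A -> A) :
  zmod_morphism D -> (forall a b, D (a * b) = a * D b + b * D a) ->
  (forall b, D (g b) = 0) ->
  exists D' : R -> R,
  [/\ zmod_morphism D', forall a b, D' (a * b) = a * D' b + b * D' a,
      forall b, D' (k b) = 0 & forall a, D' (phi a) = phi (D a)].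
Proof.
move=> DB DM D0.
pose quo x y := exists a s, [/\ invertible (phi s), phi a = x * phi s &
  phi (D a) = y * phi s + x * phi (D s)].
have inv_cancel (s x y : R) : invertible s -> s * x = s * y -> x = y.
  exact: (invertible_cancel (M := R^o)).
have quo_ex x : exists y, quo x y.
  have [a [s [si e]]] := R_fraction x; have [t st] := si.
  exists ((phi (D a) - x * phi (D s)) * t), a, s; split=> //.
  by rewrite -mulrA (mulrC t) st mulr1 subrK.
(* If s (a - b) = 0, differentiating gives s D(a - b) + (a - b) D s = 0, and the second term dies in
   [R]. *)
have phiDE a b : phi a = phi b -> phi (D a) = phi (D b).
  move=> e; have [|s [si sab]] := phi_ker (a := a - b).
    by rewrite (ring_homB hphi) e subrr.
  apply: (inv_cancel _ _ _ si); apply/eqP.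
  rewrite -subr_eq0 -mulrBr -(ring_homB hphi) -DB -(ring_homM hphi); apply/eqP.
  have := congr1 phi (DM s (a - b)).
  rewrite sab (zmod_morphism0 DB) (ring_hom0 hphi) (ring_homD hphi).
  by rewrite [phi ((a - b) * _)](ring_homM hphi) (ring_homB hphi) e subrr mul0r addr0.
have quo_fun x y y' : quo x y -> quo x y' -> y = y'.
  move=> [a [s [si ea eD]]] [a' [s' [si' ea' eD']]].
  have := phiDE (a * s') (a' * s).
  rewrite !(ring_homM hphi) ea ea' mulrAC => /(_ erefl).
  rewrite !DM !(ring_homD hphi) !(ring_homM hphi) eD eD' ea ea' => e.
  apply: (inv_cancel _ _ _ si); apply: (inv_cancel _ _ _ si').
  apply/eqP; rewrite -subr_eq0; apply/eqP.
  by move/eqP: e; rewrite -subr_eq0 => /eqP e; rewrite -[RHS]e; ring.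
have [D' D'P] := choice quo_ex.
have D'E x y : quo x y -> D' x = y by apply: quo_fun.
exists D'; split=> [x x'|x x'|b|a].
- have [a [s [si ea eD]]] := D'P x; have [a' [s' [si' ea' eD']]] := D'P x'.
  apply: D'E; exists (a * s' - a' * s), (s * s'); split.
  + have [t st] := si; have [t' st'] := si'; exists (t * t').
    by rewrite (ring_homM hphi) mulrACA st st' mulr1.
  + rewrite (ring_homB hphi) !(ring_homM hphi) ea ea'.
    ring.
  + rewrite DB (ring_homB hphi) !DM !(ring_homD hphi) !(ring_homM hphi).
    rewrite ea ea' eD eD'; ring.
- have [a [s [si ea eD]]] := D'P x; have [a' [s' [si' ea' eD']]] := D'P x'.
  apply: D'E; exists (a * a'), (s * s'); split.
  + have [t st] := si; have [t' st'] := si'; exists (t * t').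
    by rewrite (ring_homM hphi) mulrACA st st' mulr1.
  + rewrite !(ring_homM hphi) ea ea'; ring.
  + rewrite !DM !(ring_homD hphi) !(ring_homM hphi) ea ea' eD eD'; ring.
(* An element of [K] is a fraction of constants, and [D] kills both numerator and denominator. *)
- have [a [s [si e]]] := K_fraction b.
  apply: D'E; exists (g a), (g s); split.
  + by rewrite -k_psi; apply: invertible_hom.
  + by rewrite -!k_psi -e (ring_homM hk).
  + by rewrite !D0 (ring_hom0 hphi) mul0r mulr0 addr0.
- apply: D'E; exists a, 1; split.
  + by exists 1; rewrite (ring_hom1 hphi) mulr1.
  + by rewrite (ring_hom1 hphi) mulr1.
  + rewrite (ring_hom1 hphi) mulr1.
    have D1 : D 1 = 0 by rewrite -(rmorph1 g) D0.
    by rewrite D1 (ring_hom0 hphi) mulr0 addr0.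
Qed.

(** The module is free on the differentials of the last r coordinates, with dual basis [lam];
    divisibility by p is then read off coordinate by coordinate. *)
Lemma smooth_kahler_torsion p (Om : lmodType R) (d : R -> Om) :
  standard_smooth g -> is_kahler k d ->
  p_torsion_multiple p R -> p_torsion_multiple p Om.
Proof.
move=> [c [r [v [f [ev_surj ev_ker J_inv]]]]] hd tR.
have lam_ex (l : 'I_r) : exists lam : Om -> R, semilinear_form id lam /\
    forall l', lam (d (phi (v (rshift c l')))) = (l' == l)%:R.
  have [D [DB DM D0 Dl]] := derivation_dual ev_surj ev_ker J_inv l.
  have [D' [D'B D'M D'0 D'phi]] := localize_derivation DB DM D0.
  have [||||lam [lam_lin lamd]] := kahler_form_lift hd (f := id) (D := D').
  - by split.
  - by [].
  - by [].
  - by [].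
  exists lam; split=> // l'.
  by rewrite lamd D'phi Dl (ring_hom_nat hphi).
have [lam lamP] := choice lam_ex.
pose dx l := d (phi (v (rshift c l))).
pose proj m := \sum_l lam l m *: dx l.
have projB : zmod_morphism proj.
  move=> m m'; rewrite /proj -sumrB; apply: eq_bigr => l _.
  by rewrite -scalerBl (lamP l).1.1.
have projZ a m : proj (a *: m) = a *: proj m.
  rewrite /proj scaler_sumr; apply: eq_bigr => l _.
  by rewrite (lamP l).1.2 scalerA.
(* The defect of the expansion of [d x] in the [dx l] is itself a derivation; it kills the
   coordinates, hence the image of A, and finally all fractions. *)
pose E x := d x - proj (d x).
have EB : zmod_morphism E.
  by move=> x y; rewrite /E (kahler_diffB hd) projB !opprD !opprK addrACA.
have EM a b : E (a * b) = a *: E b + b *: E a.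
  rewrite /E (kahler_diffM hd) (zmod_morphismD projB) !projZ !scalerBr.
  by rewrite opprD addrACA.
have E0 b : E (k b) = 0.
  by rewrite /E (kahler_diff0 hd) (zmod_morphism0 projB) subrr.
have Ephi : derivation_along g phi (E \o phi).
  split=> [a b|a b|b] /=.
  - by rewrite (ring_homB hphi) EB.
  - by rewrite (ring_homM hphi) EM.
  - by rewrite -k_psi E0.
have Ephi0 : forall a, (E \o phi) a = 0.
  apply: (derivation_along_eq0 hphi ev_surj ev_ker J_inv Ephi) => l /=.
  rewrite /E /proj (bigD1 l) //= (lamP l).2 eqxx scale1r big1 ?addr0 ?subrr //.
  by move=> l' /negbTE ll'; rewrite (lamP l').2 eq_sym ll' scale0r.
have Ex x : E x = 0.
  have [a [s [si e]]] := R_fraction x; apply: (invertible_cancel si).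
  have := EM x (phi s).
  rewrite e (Ephi0 a : E (phi a) = 0) (Ephi0 s : E (phi s) = 0).
  by rewrite scaler0 add0r => <-; rewrite scaler0.
have projE m : m = proj m.
  apply: (kahler_ext hd (f := id) (g1 := id) (g2 := proj)) => // a.
  by apply/eqP; rewrite -subr_eq0; apply/eqP; apply: Ex.
move=> m pm.
have ex l : exists x, lam l m = x *+ p.
  by apply: tR; rewrite -(zmod_morphismMn (lamP l).1.1) pm (zmod_morphism0 (lamP l).1.1).
have [x xP] := choice ex.
exists (\sum_l x l *: dx l); rewrite [LHS]projE /proj -sumrMnl.
by apply: eq_bigr => l _; rewrite xP scalerMnl.
Qed.

End Localization.

(** * The first infinitesimal neighbourhood of the diagonal *)

Section DualNumbers.
Variables (R : comPzRingType) (M : lmodType R).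

(** The square-zero extension of [R] by [M]: its ring homomorphic sections r |-> (r, D r) are the
    derivations D. *)
Definition dual_number : Type := (R * M)%type.
HB.instance Definition _ := GRing.Zmodule.on dual_number.

Definition dual_one : dual_number := (1, 0).
Definition dual_mul (x y : dual_number) : dual_number :=
  (x.1 * y.1, x.1 *: y.2 + y.1 *: x.2).

Fact dual_mulA : associative dual_mul.
Proof.
move=> [a m] [b n] [c o]; rewrite /dual_mul /= mulrA; congr pair.
by rewrite !scalerDr !scalerA (mulrC c) (mulrC c) addrA.
Qed.
Fact dual_mulC : commutative dual_mul.
Proof. by move=> [a m] [b n]; rewrite /dual_mul /= mulrC addrC. Qed.
Fact dual_mul1 : left_id dual_one dual_mul.
Proof. by move=> [a m]; rewrite /dual_mul /= mul1r scale1r scaler0 addr0. Qed.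
Fact dual_mulDl : left_distributive dual_mul +%R.
Proof.
move=> [a m] [b n] [c o]; rewrite /dual_mul /= mulrDl; congr pair.
by rewrite scalerDl scalerDr addrACA.
Qed.
HB.instance Definition _ := GRing.Zmodule_isComPzRing.Build dual_number
  dual_mulA dual_mulC dual_mul1 dual_mulDl.

Lemma dual_mulE (x y : dual_number) :
  x * y = (x.1 * y.1, x.1 *: y.2 + y.1 *: x.2).
Proof. by []. Qed.

Lemma dual_invertible (x : dual_number) : invertible x <-> invertible x.1.
Proof.
split; first by move=> [y /(congr1 fst) xy]; exists y.1.
case=> b ab; exists (b, - (b * b) *: x.2); rewrite dual_mulE /= ab.
by congr pair; rewrite scalerA mulrN mulrA ab mul1r scaleNr addNr.
Qed.

Lemma dual_local : local_ring R -> local_ring dual_number.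
Proof.
move=> [n0 loc]; split; first by move/dual_invertible.
by move=> a b /dual_invertible/loc[] h; [left|right]; apply/dual_invertible.
Qed.

Lemma dual_fst_hom : ring_hom (fst : dual_number -> R).
Proof. by split=> [x y|]. Qed.

End DualNumbers.

(** * The local algebra of the first infinitesimal neighbourhood *)

Section DiagonalAlgebra.
Variables (K R Q T : comPzRingType) (k : K -> R) (p1 p2 : R -> Q) (del : Q -> R).
Variables (pi : Q -> T) (Om : lmodType R) (d : R -> Om).
Hypotheses (hp1 : ring_hom p1) (hp2 : ring_hom p2) (hdel : ring_hom del).
Hypotheses (hpi : ring_hom pi) (hd : is_kahler k d).
Hypotheses (del1 : forall r, del (p1 r) = r) (del2 : forall r, del (p2 r) = r).
Hypothesis p12 : forall c, p1 (k c) = p2 (k c).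
Hypothesis pi_surj : forall t, exists q, pi q = t.
Hypothesis pi_ker : [set q | pi q = 0] = ideal_square [set q | del q = 0].

Lemma pi_ideal q q' : del q = 0 -> del q' = 0 -> pi q * pi q' = 0.
Proof.
move=> q0 q'0; rewrite -(ring_homM hpi).
have : [set q | pi q = 0] (q * q'); last by [].
rewrite pi_ker; exists [:: (q, q')]; split; last by rewrite big_seq1.
by move=> c; rewrite inE => /eqP ->.
Qed.

Lemma del12 r : del (p2 r - p1 r) = 0.
Proof. by rewrite (ring_homB hdel) del1 del2 subrr. Qed.

(** The difference of the two pullbacks lies in the ideal of the diagonal, so it is a derivation
    modulo the square of that ideal. *)
Lemma diagonal_differential : exists v : Om -> T,
  semilinear_form (pi \o p1) v /\
  forall r, v (d r) = pi (p2 r) - pi (p1 r).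
Proof.
apply: (kahler_form_lift hd) => [|a b|a b|c].
- exact: ring_hom_comp.
- by rewrite (ring_homB hp1) (ring_homB hp2) !(ring_homB hpi); ring.
- have := pi_ideal (del12 a) (del12 b); rewrite !(ring_homB hpi) => ab0.
  rewrite (ring_homM hp1) (ring_homM hp2) !(ring_homM hpi) /=.
  apply/eqP; rewrite -subr_eq0; apply/eqP; rewrite -[RHS]ab0; ring.
- by rewrite p12 subrr.
Qed.

Hypothesis hom_ex : forall (M : lmodType R) (D : R -> M), derivation k D ->
  exists u : Q -> dual_number M, [/\ ring_hom u, forall q, (u q).1 = del q,
    forall r, u (p1 r) = (r, 0) & forall r, u (p2 r) = (r, D r)].
Hypothesis hom_uniq : forall (M : lmodType R) (u u' : Q -> dual_number M),
  ring_hom u -> ring_hom u' ->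
  (forall q, (u q).1 = del q) -> (forall q, (u' q).1 = del q) ->
  (forall r, u (p1 r) = u' (p1 r)) -> (forall r, u (p2 r) = u' (p2 r)) ->
  u =1 u'.

(** A germ q is recovered in [T] from [del q] and the second component of [u q]. Both vanish on the
    square of the ideal, so p-torsion in [T] gives p-torsion in [R] and in [Om]; the quotients by p
    found there are brought back by [pi \o p1] and [v]. *)
Lemma diagonal_torsion p : (p ^ 2)%:R = 0 :> R ->
  p_torsion_multiple p R -> p_torsion_multiple p Om -> p_torsion_multiple p T.
Proof.
move=> p2R tR tOm t pt.
have hp : ring_hom (pi \o p1) by apply: ring_hom_comp.
have [v [[vB vZ] vd]] := diagonal_differential.
have [u [hu u1 up1 up2]] := hom_ex hd.1.
(* Test object for uniqueness: the dual numbers over [R] with coefficients in [T]. [w1] records the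
   class of q - p1 (del q) directly, [w2] records it after the detour through [Om]. *)
pose M := restriction (T^o : lmodType T) hp.
pose w1 (q : Q) : dual_number M := (del q, pi (q - p1 (del q))).
pose w2 (q : Q) : dual_number M := (del q, v (u q).2).
have scaleE (r : R) (m : M) : r *: m = pi (p1 r) * m :> T by [].
have hw1 : ring_hom w1.
  split=> [a b|].
    rewrite /w1 (ring_homB hdel) (ring_homB hp1); congr pair.
    rewrite !(ring_homB hpi).
    have aux (x y z t' : T) : (x - y) - (z - t') = (x - z) - (y - t') by ring.
    exact: aux.
  split=> [|a b].
    rewrite /w1 (ring_hom1 hdel) (ring_hom1 hp1) subrr (ring_hom0 hpi).
    by [].
  rewrite dual_mulE /w1 /= (ring_homM hdel); congr pair.
  have ab0 : pi (a - p1 (del a)) * pi (b - p1 (del b)) = 0.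
    by apply: pi_ideal; rewrite (ring_homB hdel) del1 subrr.
  rewrite !scaleE (ring_homM hp1).
  apply/eqP; rewrite -subr_eq0; apply/eqP; move: ab0.
  rewrite !(ring_homB hpi) !(ring_homM hpi) => ab0; rewrite -[RHS]ab0.
  ring.
have hw2 : ring_hom w2.
  split=> [a b|].
    by rewrite /w2 (ring_homB hdel) (ring_homB hu) vB.
  split=> [|a b].
    by rewrite /w2 (ring_hom1 hdel) (ring_hom1 hu) (zmod_morphism0 vB).
  rewrite dual_mulE /w2 /= (ring_homM hdel) (ring_homM hu) dual_mulE /=.
  by rewrite (zmod_morphismD vB) !vZ !u1.
have w12 q : pi (q - p1 (del q)) = v (u q).2.
  suff /(congr1 snd) : w1 q = w2 q by [].
  apply: hom_uniq => // r; rewrite /w1 /w2.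
    by rewrite del1 subrr (ring_hom0 hpi) up1 /= (zmod_morphism0 vB).
  by rewrite del2 up2 /= vd (ring_homB hpi).
have [q eq] := pi_surj t.
have p2Q : (p ^ 2)%:R = 0 :> Q.
  by rewrite -(ring_hom_nat hp1) p2R (ring_hom0 hp1).
have : pi (q *+ p) = 0 by rewrite (ring_homMn hpi) eq.
move=> piqp.
(* An element killed by [pi] is a sum of products of elements of the ideal, and [del] kills each
   factor. *)
have delqp : del q *+ p = 0.
  have : [set q | pi q = 0] (q *+ p) by [].
  rewrite pi_ker -(ring_homMn hdel) => -[s [sI ->]].
  rewrite (zmod_morphism_sum hdel.1) big_seq big1 // => c /sI[c1 c2].
  by rewrite (ring_homM hdel) c1 mul0r.
have [r' er'] := tR _ delqp.
pose b := q - p1 (del q).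
(* The second component of a product of two elements of the ideal vanishes, since both first
   components are 0. *)
have ub : (u b).2 *+ p = 0.
  have -> : (u b).2 *+ p = (u (b *+ p)).2 by rewrite (ring_homMn hu) raddfMn.
  have bp : b *+ p = q *+ p.
    rewrite /b mulrnBl -(ring_homMn hp1) delqp (ring_hom0 hp1) subr0.
    by [].
  rewrite bp.
  have : [set q | pi q = 0] (q *+ p) by [].
  rewrite pi_ker => -[s [sI ->]].
  rewrite (zmod_morphism_sum hu.1) raddf_sum big_seq big1 // => c /sI[c1 c2].
  by rewrite (ring_homM hu) dual_mulE /= !u1 c1 c2 !scale0r addr0.
have [om eom] := tOm _ ub.
have bE : pi b = v om *+ p.
  have -> : b = b - p1 (del b).
    by rewrite {3}/b (ring_homB hdel) del1 subrr (ring_hom0 hp1) subr0.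
  by rewrite w12 eom (zmod_morphismMn vB).
exists (v om + pi (p1 r')).
rewrite -eq -[q](subrK (p1 (del q))) -/b (ring_homD hpi) bE er' mulrnDl.
by rewrite (ring_homMn hp1) (ring_homMn hpi).
Qed.

End DiagonalAlgebra.

(** * Stalks of fibre products *)

Lemma invertibleM (A : comPzRingType) (a b : A) :
  invertible (a * b) <-> invertible a /\ invertible b.
Proof.
split=> [[c abc]|[[c ac] [d bd]]].
  split; [exists (b * c)|exists (a * c)]; first by rewrite mulrA.
  by rewrite mulrA (mulrC b).
by exists (c * d); rewrite mulrACA ac bd mulr1.
Qed.

(** Units of the stalk are detected on numerators. If neither numerator were a unit, both would lie
    in the prime of the point, and so would a numerator of the sum. *)
Lemma scheme_locally_ringed (X : ringed_space) : is_scheme X -> locally_ringed X.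
Proof.
move=> schX x; have [U [A [phi [Ux [_ [hphi prime _ _ frac]]]]]] := schX x.
have [hx _] := hphi x Ux; have [P0 P1 PB PM _] := prime x Ux.
have [fr _] := frac x Ux; split.
  by move: P0; rewrite /= (ring_hom0 hx).
move=> a b ab; have [a1 [s [si ea]]] := fr a; have [b1 [t [ti eb]]] := fr b.
have num a' a1' s' : a' * phi x s' = phi x a1' -> invertible (phi x a1') ->
    invertible a'.
  by move=> <- /invertibleM[].
have [ia|na] := pselect (invertible (phi x a1)).
  by left; apply: num ea ia.
have [ib|nb] := pselect (invertible (phi x b1)).
  by right; apply: num eb ib.
exfalso; have : [set c | ~ invertible (phi x c)] (t * a1 - (- s) * b1).
  by apply: PB; apply: PM.
apply; rewrite mulNr opprK (ring_homD hx) !(ring_homM hx) -ea -eb.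
have -> : phi x t * (a * phi x s) + phi x s * (b * phi x t) =
    (a + b) * (phi x s * phi x t).
  by rewrite mulrDl; congr (_ + _); rewrite mulrC -!mulrA // (mulrC (phi x t)).
by apply/invertibleM; split=> //; apply/invertibleM.
Qed.

Lemma germ_ex (X : ringed_space) (x : X) (a : stalk x) :
  exists s : forall y, stalk y, regular s x /\ s x = a.
Proof. by case: (regular_sheaf X) => _ _ + _; apply. Qed.

Lemma regular_near_eq (X : ringed_space) (s t : forall y : X, stalk y) x :
  regular s x -> regular t x -> s x = t x -> \forall y \near x, s y = t y.
Proof. by case: (regular_sheaf X) => _ _ _; apply. Qed.

Lemma regular_transfer (X : ringed_space) (s t : forall y : X, stalk y) x :
  regular s x -> (\forall y \near x, s y = t y) -> regular t x.
Proof. by case: (regular_sheaf X) => _ + _ _; apply. Qed.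

(** * One-point spaces as test objects *)

Definition point : Type := unit.
HB.instance Definition _ := Choice.on point.
HB.instance Definition _ := isOpenTopological.Build point
  (op := setT) I (fun _ _ _ _ => I) (fun _ _ _ => I).

Section PointSpace.
Variable R : comPzRingType.

Fact point_sheaf : @is_sheaf point (fun=> R) (fun _ _ => True).
Proof.
split.
- by move=> s x _; apply: filterS filterT.
- by [].
- by move=> x a; exists (fun=> a).
- move=> s t [] _ _ e; apply: (filterS (P := setT)); last exact: filterT.
  by case=> _.
Qed.

Definition point_space : ringed_space :=
  @RingedSpace point (fun=> R) (fun _ _ => True) point_sheaf (fun=> I)
    (fun _ _ _ _ _ => I) (fun _ _ _ _ _ => I).

(* A local homomorphism from the stalk at x is a morphism from a one-point
   space. *)
Definition point_mor (X : ringed_space) (x : X) (q : stalk x -> R) :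
    raw_morphism point_space X :=
  @RawMorphism point_space X (fun=> x) (fun=> q).

Lemma point_morP (X : ringed_space) (x : X) (q : stalk x -> R) :
  ring_hom q -> (forall a, invertible (q a) -> invertible a) ->
  morphism (point_mor q).
Proof.
move=> hq lq [] _; split=> // A /nbhs_singleton Ax.
exact: (@filterS point (nbhs (tt : point)) _ setT _ (fun y _ => Ax) filterT).
Qed.

End PointSpace.

Section StalkMap.
Variables (X Y : ringed_space) (f : raw_morphism X Y) (x : X) (y : Y).
Hypothesis e : f x = y.

(** Pullback of germs at a point only provably equal to [f x]; [stalk_mapE] removes the transport
    once the germ is the value of a family. *)
Definition stalk_map : stalk y -> stalk x :=
  eq_rect _ (fun z => stalk z -> stalk x) (@on_stalk _ _ f x) _ e.

Lemma stalk_mapE (a : forall z, stalk z) :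
  stalk_map (a y) = on_stalk (r := f) (a (f x)).
Proof. by rewrite /stalk_map; case: y / e. Qed.

Lemma stalk_map_hom : ring_hom (@on_stalk _ _ f x) -> ring_hom stalk_map.
Proof. by rewrite /stalk_map; case: y / e. Qed.

End StalkMap.

Lemma morphism_stalk_hom (X Y : ringed_space) (f : raw_morphism X Y) x :
  morphism f -> ring_hom (@on_stalk _ _ f x).
Proof. by move=> mf; case: (mf x I). Qed.

Lemma morphism_stalk_local (X Y : ringed_space) (f : raw_morphism X Y) x a :
  morphism f -> invertible (on_stalk (r := f) (x := x) a) -> invertible a.
Proof. by move=> mf; case: (mf x I) => _ _ + _; apply. Qed.

Lemma morphism_comp (X Y Z : ringed_space) (g : raw_morphism Y Z)
    (f : raw_morphism X Y) (W : set Y) (V : set X) :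
  morphism_on W g -> morphism_on V f -> V `<=` f @^-1` W ->
  morphism_on V (mor_comp g f).
Proof.
move=> mg mf VW x Vx; have [cf hf lf rf] := mf x Vx.
have [cg hg lg rg] := mg (f x) (VW x Vx); split.
- exact: (@continuous_comp _ _ _ f g x cf cg).
- exact: ring_hom_comp.
- by move=> a /lf/lg.
- by move=> s /rg/rf.
Qed.

Section FibreProduct.
Variables (X Y Z P : ringed_space) (f : raw_morphism X Z) (g : raw_morphism Y Z).
Variables (p1 : raw_morphism P X) (p2 : raw_morphism P Y).
Hypothesis hP : is_fiber_product f g p1 p2.
Variables (R : comPzRingType) (Rloc : local_ring R).

(** The two local homomorphisms are morphisms from a one-point space. Their factorization through
    [P] consists of a point [z], not known in advance, and a homomorphism out of its stalk. *)
Lemma fiber_product_point_ex (x : X) (y : Y) (q1 : stalk x -> R)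
    (q2 : stalk y -> R) :
  ring_hom q1 -> (forall a, invertible (q1 a) -> invertible a) ->
  ring_hom q2 -> (forall a, invertible (q2 a) -> invertible a) ->
  f x = g y ->
  (forall c : forall z : Z, stalk z,
     q1 (on_stalk (r := f) (c (f x))) = q2 (on_stalk (r := g) (c (g y)))) ->
  exists (z : P) (u : stalk z -> R),
    [/\ ring_hom u, forall a, invertible (u a) -> invertible a,
        p1 z = x /\ (forall a : forall x, stalk x,
          u (on_stalk (r := p1) (a (p1 z))) = q1 (a x)) &
        p2 z = y /\ (forall a : forall y, stalk y,
          u (on_stalk (r := p2) (a (p2 z))) = q2 (a y))].
Proof.
move=> hq1 lq1 hq2 lq2 fg cfg; case: hP => _ _ _ _.
move=> /(_ (point_space R) (point_mor q1) (point_mor q2)) [].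
- by case.
- exact: point_morP.
- exact: point_morP.
- by move=> [] _; split.
move=> [u [mu e1 e2]] _.
exists (u tt), (@on_stalk _ _ u tt); split.
- exact: morphism_stalk_hom.
- by have [_ _ + _] := mu tt I.
- exact: (e1 tt I).
- exact: (e2 tt I).
Qed.

(** The two points are not assumed equal: this is part of what uniqueness of the factorization
    yields. *)
Lemma fiber_product_point_uniq (z z' : P) (u : stalk z -> R) (u' : stalk z' -> R) :
  ring_hom u -> (forall a, invertible (u a) -> invertible a) ->
  ring_hom u' -> (forall a, invertible (u' a) -> invertible a) ->
  p1 z = p1 z' -> (forall a : forall x, stalk x,
    u (on_stalk (r := p1) (a (p1 z))) = u' (on_stalk (r := p1) (a (p1 z')))) ->
  p2 z = p2 z' -> (forall a : forall x, stalk x,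
    u (on_stalk (r := p2) (a (p2 z))) = u' (on_stalk (r := p2) (a (p2 z')))) ->
  z = z' /\ forall s : forall z, stalk z, u (s z) = u' (s z').
Proof.
move=> hu lu hu' lu' e1 a1 e2 a2; case: hP => _ mp1 mp2 pfg.
have mu := point_morP hu lu; have mu' := point_morP hu' lu'.
move=> /(_ (point_space R) (mor_comp p1 (point_mor u))
  (mor_comp p2 (point_mor u))) [].
- by case.
- exact: (morphism_comp mp1 mu).
- exact: (morphism_comp mp2 mu).
- move=> [] _; have [ez es] := pfg z I; split=> [|c] /=; first exact: ez.
  by congr u; apply: es.
move=> _ uniq; apply: (uniq (point_mor u) (point_mor u') _ _ tt I); split=> //.
- by case=> _; split=> [|s] /=; rewrite ?e1 ?a1.
- by case=> _; split=> [|s] /=; rewrite ?e2 ?a2.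
Qed.

End FibreProduct.

(** * Torsion in the lifted spaces *)

#[local] Arguments XS_mor [p] l x _.
#[local] Arguments relF_mor [p] l x _.
#[local] Arguments relF_X [p] l x _.
#[local] Arguments relF_S [p] l x _.
#[local] Arguments tS_flat [p] l x.
#[local] Arguments inX'_S [p] l x _.
#[local] Arguments tU_scheme [p D] l x.
#[local] Arguments tUS_mor [p D] l x _.
#[local] Arguments inU_S [p D] l x _.
#[local] Arguments T_scheme [p D L] d x.
#[local] Arguments tdelta_mor [p D L] d x _.
#[local] Arguments tTP_mor [p D L] d x _.
#[local] Arguments diagonal1 [p D L] d x _.
#[local] Arguments diagonal2 [p D L] d x _.
#[local] Arguments tTP_ideal [p D L] d x.
#[local] Arguments h1_mor [p D L] d x _.
#[local] Arguments h2_mor [p D L] d x _.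
#[local] Arguments h1_red [p D L] d x _.
#[local] Arguments h2_red [p D L] d x _.

Lemma nat_stalk_map (X Y : ringed_space) (f : raw_morphism X Y) x n :
  morphism f -> n%:R = 0 :> stalk (f x) -> n%:R = 0 :> stalk x.
Proof.
move=> mf n0; have hf := morphism_stalk_hom x mf.
by rewrite -(ring_hom_nat hf) n0 (ring_hom0 hf).
Qed.

Lemma smooth_differentials_torsion (X Y : ringed_space) (f : raw_morphism X Y)
    (Om : differentials f) p x :
  morphism f -> smooth f -> p_torsion_multiple p (stalk x) ->
  p_torsion_multiple p (Om x).
Proof.
move=> mf [_ /(_ x)[U [A [phi [V [B [psi [g [[Ux cU] cV UV eg sg]]]]]]]]] tx.
have [_ [hphi _ _ _ fphi]] := cU; have [_ [_ _ _ _ fpsi]] := cV.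
have [fr ker] := fphi x Ux; have [fr' _] := fpsi _ (UV x Ux).
apply: (smooth_kahler_torsion (hphi x Ux).1 (morphism_stalk_hom x mf)
  (eg x Ux) fr ker fr' sg (@diff_kahler _ _ _ Om x)) => //.
Qed.

Section Torsion.
Variables (p : nat) (p_prime : prime p) (D : lifted_frobenius_twist p).
Variable L : lifted_open D.

Lemma tU_p2 (x : tU L) : (p ^ 2)%:R = 0 :> stalk x.
Proof.
by have [p2 _] := tS_flat D (tUS L x); exact: nat_stalk_map (tUS_mor L) p2.
Qed.

Lemma tU_torsion (x : tU L) : p_torsion_multiple p (stalk x).
Proof.
have [p2 fl] := tS_flat D (tUS L x).
apply: (flat_torsion (morphism_stalk_hom x (tUS_mor L)) _ p2).
  by have [+ _] := tUS_smooth L; apply.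
exact: Zp2_torsion.
Qed.

Variable N : diagonal_neighborhood L.

Lemma th1_mor : morphism (th1 N).
Proof.
have [_ mp _ _ _] := tP_product N.
exact: (morphism_comp mp (tTP_mor N)).
Qed.

Lemma th2_mor : morphism (th2 N).
Proof.
have [_ _ mp _ _] := tP_product N.
exact: (morphism_comp mp (tTP_mor N)).
Qed.

Section AtPoint.
Variable x : tU L.
Let z := tTP N (tdelta N x).

Lemma diag1 : pr1 N z = x. Proof. by have [] := diagonal1 N x I. Qed.
Lemma diag2 : pr2 N z = x. Proof. by have [] := diagonal2 N x I. Qed.

Let q1 : stalk x -> stalk z := stalk_map diag1.
Let q2 : stalk x -> stalk z := stalk_map diag2.
Let del : stalk z -> stalk x := @on_stalk _ _ (mor_comp (tTP N) (tdelta N)) x.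
Let pi : stalk z -> stalk (tdelta N x) := @on_stalk _ _ (tTP N) (tdelta N x).
Let k : stalk (tUS L x) -> stalk x := @on_stalk _ _ (tUS L) x.

Lemma diag_hom1 : ring_hom q1.
Proof.
by have [_ mp _ _ _] := tP_product N; apply/stalk_map_hom/morphism_stalk_hom.
Qed.

Lemma diag_hom2 : ring_hom q2.
Proof.
by have [_ _ mp _ _] := tP_product N; apply/stalk_map_hom/morphism_stalk_hom.
Qed.

Lemma diag_mor : morphism (mor_comp (tTP N) (tdelta N)).
Proof. exact: (morphism_comp (tTP_mor N) (tdelta_mor N)). Qed.

Lemma diag_homd : ring_hom del.
Proof. exact: morphism_stalk_hom diag_mor. Qed.

Lemma diag_retract1 r : del (q1 r) = r.
Proof.
have [a [_ <-]] := germ_ex r; rewrite /q1 stalk_mapE.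
by have [_ +] := diagonal1 N x I; apply.
Qed.

Lemma diag_retract2 r : del (q2 r) = r.
Proof.
have [a [_ <-]] := germ_ex r; rewrite /q2 stalk_mapE.
by have [_ +] := diagonal2 N x I; apply.
Qed.

Lemma diag_base c : q1 (k c) = q2 (k c).
Proof.
have [s [_ <-]] := germ_ex c.
pose a z := on_stalk (r := tUS L) (x := z) (s (tUS L z)).
rewrite -[k _]/(a x) /q1 /q2 !stalk_mapE.
by have [_ _ _ pfg _] := tP_product N; have [_ +] := pfg z I; apply.
Qed.

Lemma diag_surj t : exists q, pi q = t.
Proof. by have [] := tTP_ideal N x. Qed.

Lemma diag_ker : [set q | pi q = 0] = ideal_square [set q | del q = 0].
Proof. by have [] := tTP_ideal N x. Qed.

Lemma diag_local : local_ring (stalk x).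
Proof. exact: scheme_locally_ringed (tU_scheme L) x. Qed.

(** The homomorphisms r |-> (r, 0) and r |-> (r, der r) agree on functions from tS because [der]
    kills them; together they define a tangent vector of the product at the diagonal. *)
Lemma diag_point (M : lmodType (stalk x)) (der : stalk x -> M) :
  derivation k der ->
  exists u : stalk z -> dual_number M,
    [/\ ring_hom u, forall q, (u q).1 = del q,
    forall r, u (q1 r) = (r, 0) & forall r, u (q2 r) = (r, der r)].
Proof.
move=> [derB derM der0].
pose i1 r : dual_number M := (r, 0); pose i2 r : dual_number M := (r, der r).
have hi1 : ring_hom i1.
  split=> [a b|]; first by rewrite /i1; congr pair; rewrite /= subr0.
  by split=> // a b; rewrite dual_mulE /= !scaler0 addr0.
have hi2 : ring_hom i2.
  split=> [a b|]; first by rewrite /i2 derB.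
  split=> [|a b]; last by rewrite dual_mulE /= -derM.
  rewrite /i2; congr pair; have := der0 1.
  by rewrite [k 1](ring_hom1 (morphism_stalk_hom x (tUS_mor L))).
have [||||||z' [u [hu lu [e1 u1] [e2 u2]]]] :=
  fiber_product_point_ex (tP_product N) (@dual_local _ M diag_local)
    (q1 := i1) (q2 := i2).
- by [].
- by move=> a /dual_invertible.
- by [].
- by move=> a /dual_invertible.
- by [].
- move=> c; rewrite /i1 /i2; congr pair.
  by rewrite der0.
have hfst := dual_fst_hom M.
(* The point [z'] is still unknown. Forgetting the second component gives a point of the product
   with both projections the identity of the stalk, as [del] does at [z]; hence z' = z. *)
have [||||||||ez es] := fiber_product_point_uniq (tP_product N) diag_local
    (z := z') (z' := z) (u := fst \o u) (u' := del).
- exact: ring_hom_comp.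
- by move=> a /= /dual_invertible/lu.
- exact: diag_homd.
- by move=> a; apply: (morphism_stalk_local diag_mor).
- by rewrite e1 diag1.
- move=> a; rewrite /= u1 /=.
  by have [_ e] := diagonal1 N x I; apply/esym/e.
- by rewrite e2 diag2.
- move=> a; rewrite /= u2 /=.
  by have [_ e] := diagonal2 N x I; apply/esym/e.
subst z'; exists u; split=> //.
- by move=> q; have [s [_ <-]] := germ_ex q; apply: es.
- move=> r; have [a [_ <-]] := germ_ex r.
  by rewrite /q1 stalk_mapE u1.
- move=> r; have [a [_ <-]] := germ_ex r.
  by rewrite /q2 stalk_mapE u2.
Qed.

(** Locality of both homomorphisms is inherited from [del], since a dual number is invertible as
    soon as its first component is. *)
Lemma diag_point_uniq (M : lmodType (stalk x))
    (u u' : stalk z -> dual_number M) : ring_hom u -> ring_hom u' ->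
  (forall q, (u q).1 = del q) -> (forall q, (u' q).1 = del q) ->
  (forall r, u (q1 r) = u' (q1 r)) -> (forall r, u (q2 r) = u' (q2 r)) ->
  u =1 u'.
Proof.
move=> hu hu' ud ud' e1 e2 q.
have loc (w : stalk z -> dual_number M) : (forall q, (w q).1 = del q) ->
    forall a, invertible (w a) -> invertible a.
  move=> wd a /dual_invertible; rewrite wd.
  exact: (morphism_stalk_local diag_mor).
have [s [_ <-]] := germ_ex q.
apply: (fiber_product_point_uniq (tP_product N)
  (@dual_local _ M diag_local) hu (loc _ ud) hu' (loc _ ud') _ _ _ _).2 => //.
- by move=> a; have := e1 (a x); rewrite /q1 stalk_mapE.
- by move=> a; have := e2 (a x); rewrite /q2 stalk_mapE.
Qed.

Lemma diag_torsion (OmtU : differentials (tUS L)) :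
  p_torsion_multiple p (stalk (tdelta N x)).
Proof.
apply: (diagonal_torsion diag_hom1 diag_hom2 diag_homd
  (morphism_stalk_hom _ (tTP_mor N)) (@diff_kahler _ _ _ OmtU x)
  diag_retract1 diag_retract2 diag_base diag_surj diag_ker diag_point
  diag_point_uniq (tU_p2 x)).
  exact: tU_torsion.
by apply: smooth_differentials_torsion (tUS_mor L) (tUS_smooth L) (@tU_torsion x).
Qed.

End AtPoint.

Lemma tdelta_surj (y : tT N) : exists x, y = tdelta N x.
Proof. by have [g _ gK] := tdelta_bij N; exists (g y). Qed.

Lemma th12 (y : tT N) : th1 N y = th2 N y.
Proof.
have [x ->] := tdelta_surj y.
exact: (etrans (diag1 x) (esym (diag2 x))).
Qed.

Lemma tT_p2 (y : tT N) : (p ^ 2)%:R = 0 :> stalk y.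
Proof. exact: nat_stalk_map th1_mor (tU_p2 (th1 N y)). Qed.

Lemma tT_torsion (OmtU : differentials (tUS L)) (y : tT N) :
  p_torsion_multiple p (stalk y).
Proof. by have [x ->] := tdelta_surj y; apply: diag_torsion. Qed.

Lemma th_square_zero (y : tT N) (a b : forall u : tU L, stalk u) :
  (on_stalk (r := th2 N) (a (th2 N y)) - on_stalk (r := th1 N) (a (th1 N y))) *
  (on_stalk (r := th2 N) (b (th2 N y)) - on_stalk (r := th1 N) (b (th1 N y)))
  = 0.
Proof.
have [x ->] := tdelta_surj y.
have hpi := morphism_stalk_hom (tdelta N x) (tTP_mor N).
have aux (c : forall u : tU L, stalk u) :
    on_stalk (r := th2 N) (c (th2 N (tdelta N x))) -
    on_stalk (r := th1 N) (c (th1 N (tdelta N x))) =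
    on_stalk (r := tTP N) (stalk_map (diag2 x) (c x) - stalk_map (diag1 x) (c x)).
  by rewrite (ring_homB hpi) !stalk_mapE.
rewrite !aux.
by apply: (pi_ideal hpi (diag_ker x)); apply: del12;
  [exact: diag_homd|exact: diag_retract1|exact: diag_retract2
  |exact: diag_homd|exact: diag_retract1|exact: diag_retract2].
Qed.

Lemma th_differential (OmtU : differentials (tUS L)) (y : tT N) :
  exists v : OmtU (th1 N y) -> stalk y,
    semilinear_form (@on_stalk _ _ (th1 N) y) v /\
    forall a : forall u : tU L, stalk u, v (diff OmtU (a (th1 N y))) =
      on_stalk (r := th2 N) (a (th2 N y)) - on_stalk (r := th1 N) (a (th1 N y)).
Proof.
(* Stated at an arbitrary [x] with a proof of [th1 N y = x]: on the diagonal the two points are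
   equal only by proof, and the module of differentials depends on the point. *)
suff [x [e [v [hv vd]]]] : exists x (e : th1 N y = x) (v : OmtU x -> stalk y),
    semilinear_form (stalk_map e) v /\
    forall a : forall u : tU L, stalk u, v (diff OmtU (a x)) =
      on_stalk (r := th2 N) (a (th2 N y)) - on_stalk (r := th1 N) (a (th1 N y)).
  by case: x / e v hv vd => v hv vd; exists v.
have [x ->] := tdelta_surj y.
have [v [hv vd]] := diagonal_differential (diag_hom1 x) (diag_hom2 x)
  (diag_homd x) (morphism_stalk_hom _ (tTP_mor N)) (@diff_kahler _ _ _ OmtU x)
  (diag_retract1 (x := x)) (diag_retract2 (x := x)) (diag_base (x := x))
  (diag_ker x).
have e : th1 N (tdelta N x) = x := diag1 x.
exists x, e, v; split; last by move=> a; rewrite vd !stalk_mapE.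
suff <- : @on_stalk _ _ (tTP N) (tdelta N x) \o stalk_map (diag1 x) =
    stalk_map e by [].
apply/funext => r; have [a [_ <-]] := germ_ex r.
by rewrite /= !stalk_mapE.
Qed.

End Torsion.

(** * Differences of liftings *)

Section TimesP.
Variables (p : nat) (A B : zmodType) (red : A -> B).
Hypotheses (redB : zmod_morphism red) (p2 : forall a : A, a *+ p *+ p = 0).
Hypothesis red_ker : forall a, red a = 0 <-> exists c, a = c *+ p.

(** Two liftings of one element differ by a multiple of p, which is killed by a further
    multiplication by p. *)
Lemma times_pE a : times_p p red (red a) = a *+ p.
Proof.
apply: xget_unique; first by exists a.
move=> _ [a' [ea ->]]; apply/eqP; rewrite -subr_eq0 -mulrnBl.
have /red_ker[c ->] : red (a' - a) = 0 by rewrite redB ea subrr.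
by rewrite p2.
Qed.

Hypothesis red_surj : forall b, exists a, red a = b.
Hypothesis torsion : p_torsion_multiple p A.

Lemma times_p_inj : injective (times_p p red).
Proof.
move=> b b'; have [a <-] := red_surj b; have [a' <-] := red_surj b'.
rewrite !times_pE => e; apply/eqP; rewrite -subr_eq0 -redB; apply/eqP/red_ker.
by apply: torsion; rewrite mulrnBl e subrr.
Qed.

Lemma times_pB : zmod_morphism (times_p p red).
Proof.
move=> b b'; have [a <-] := red_surj b; have [a' <-] := red_surj b'.
by rewrite -redB !times_pE mulrnBl.
Qed.

End TimesP.

(** * The divided difference of two ring homomorphisms *)

Section DifferenceAlgebra.
Variables (p : nat) (K' A A' B B' : comPzRingType) (k : K' -> A').
Variables (rA : A -> A') (rB : B -> B') (g1 g2 : A -> B) (f : A' -> B').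
Variables (Om : lmodType A') (d : A' -> Om) (hd : is_kahler k d).
Hypotheses (hrA : ring_hom rA) (hrB : ring_hom rB) (hg1 : ring_hom g1).
Hypotheses (hg2 : ring_hom g2) (hf : ring_hom f).
Hypotheses (rg1 : forall a, rB (g1 a) = f (rA a)).
Hypotheses (rg2 : forall a, rB (g2 a) = f (rA a)).
Hypotheses (rA_surj : forall a', exists a, rA a = a').
Hypotheses (rB_surj : forall b', exists b, rB b = b').
Hypotheses (rA_ker : forall a, rA a = 0 -> exists c, a = c *+ p).
Hypotheses (rB_ker : forall b, rB b = 0 <-> exists c, b = c *+ p).
Hypotheses (p2 : (p ^ 2)%:R = 0 :> B) (tB : p_torsion_multiple p B).
Hypothesis base : forall c, exists a, rA a = k c /\ g1 a = g2 a.

Lemma mulrn_p2 (b : B) : b *+ p *+ p = 0.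
Proof. by rewrite -mulrnA mulnn -mulr_natr p2 mulr0. Qed.

(** The map a |-> (g2 a - g1 a) / p depends only on the reduction of a, is a derivation along [f],
    and kills [k c] by [base]; the universal property makes it linear on [Om]. *)
Lemma difference_form : exists xi : Om -> B', semilinear_form f xi /\
  forall a, g2 a - g1 a = times_p p rB (xi (d (rA a))).
Proof.
have tE := times_pE hrB.1 mulrn_p2 rB_ker.
have tI := times_p_inj hrB.1 mulrn_p2 rB_ker rB_surj tB.
have ker a : exists c, g2 a - g1 a = c *+ p.
  by apply/rB_ker; rewrite (ring_homB hrB) rg1 rg2 subrr.
have ex a : exists c, g2 a - g1 a = times_p p rB c.
  by have [c e] := ker a; exists (rB c); rewrite tE.
have [lift liftK] := choice rA_surj.
have [D0 D0P] := choice ex.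
(* If a - a' = p c, then g2 - g1 takes on it the value p (g2 c - g1 c), which lies in p^2 B = 0. *)
have D0_ext a a' : rA a = rA a' -> D0 a = D0 a'.
  move=> e; apply: tI; rewrite -!D0P; apply/eqP; rewrite -subr_eq0.
  have [|c ec] := rA_ker (a := a - a'); first by rewrite (ring_homB hrA) e subrr.
  have -> : g2 a - g1 a - (g2 a' - g1 a') = g2 (a - a') - g1 (a - a').
    by rewrite (ring_homB hg1) (ring_homB hg2); ring.
  rewrite ec (ring_homMn hg1) (ring_homMn hg2) -mulrnBl.
  by have [c' ->] := ker c; rewrite mulrn_p2.
pose Dv a' := D0 (lift a').
have DvE a : Dv (rA a) = D0 a by apply: D0_ext; rewrite liftK.
have [||||xi [xi_lin xid]] := kahler_form_lift hd (f := f) (D := Dv).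
- by [].
- move=> a' b'; have [a <-] := rA_surj a'; have [b <-] := rA_surj b'.
  rewrite -(ring_homB hrA) !DvE; apply: tI; rewrite -D0P.
  rewrite (times_pB hrB.1 mulrn_p2 rB_ker rB_surj) -!D0P.
  by rewrite (ring_homB hg1) (ring_homB hg2); ring.
- move=> a' b'; have [a <-] := rA_surj a'; have [b <-] := rA_surj b'.
  rewrite -(ring_homM hrA) !DvE.
  have [ca eca] := ker a; have [cb ecb] := ker b.
  have ea : D0 a = rB ca by apply: tI; rewrite -D0P tE.
  have eb : D0 b = rB cb by apply: tI; rewrite -D0P tE.
  (* One coefficient is lifted through [g1] and the other through [g2]: with this mixed choice the
     Leibniz rule is an exact identity upstairs. *)
  rewrite ea eb -rg1 -rg2 -!(ring_homM hrB) -(ring_homD hrB).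
  apply: tI; rewrite -D0P tE mulrnDl -!mulrnAr -eca -ecb.
  by rewrite (ring_homM hg1) (ring_homM hg2); ring.
- move=> c; have [a [<- ea]] := base c.
  rewrite DvE; apply: tI; rewrite -D0P ea subrr.
  by rewrite -(ring_hom0 hrB) tE mul0rn.
exists xi; split=> // a.
by rewrite xid DvE -D0P.
Qed.

End DifferenceAlgebra.

Section ModuleSheaf.
Variables (X : ringed_space) (M : module_sheaf X).
Implicit Types s t : forall x, M x.

Lemma mgerm_ex (x : X) (a : M x) : exists s, mregular s x /\ s x = a.
Proof. by case: (mregular_sheaf M) => _ _ + _; apply. Qed.

Lemma mregular_near_eq s t x : mregular s x -> mregular t x -> s x = t x ->
  \forall y \near x, s y = t y.
Proof. by case: (mregular_sheaf M) => _ _ _; apply. Qed.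

Lemma mregularD s t x : mregular s x -> mregular t x ->
  mregular (fun y => s y + t y) x.
Proof.
move=> hs ht; have := mregularB hs (mregularB (mregularB ht ht) ht).
congr (mregular _ x); apply: functional_extensionality_dep => y.
by rewrite subrr sub0r opprK.
Qed.

Lemma mregular0 x : mregular (fun y => 0 : M y) x.
Proof.
have [s [hs _]] := mgerm_ex (0 : M x); have := mregularB hs hs.
by congr (mregular _ x); apply: functional_extensionality_dep => y; rewrite subrr.
Qed.

End ModuleSheaf.

Lemma regularD (X : ringed_space) (s t : forall x : X, stalk x) x :
  regular s x -> regular t x -> regular (fun y => s y + t y) x.
Proof.
move=> hs ht; have := regularB hs (regularB (regularB ht ht) ht).
congr (regular _ x); apply: functional_extensionality_dep => y.
by rewrite subrr sub0r opprK.
Qed.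

Lemma regular0 (X : ringed_space) (x : X) : regular (fun y => 0 : stalk y) x.
Proof.
have := regularB (regular1 x) (regular1 x).
by congr (regular _ x); apply: functional_extensionality_dep => y; rewrite subrr.
Qed.

Lemma regularMn (X : ringed_space) (s : forall x : X, stalk x) x n :
  regular s x -> regular (fun y => s y *+ n) x.
Proof.
move=> hs; elim: n => [|n IH]; first exact: regular0.
have := regularD hs IH.
by congr (regular _ x); apply: functional_extensionality_dep => y; rewrite mulrS.
Qed.

Lemma morphism_near (X Y : ringed_space) (f : raw_morphism X Y) (W : set X) x
    (P : Y -> Prop) :
  morphism_on W f -> W x -> (\forall y \near f x, P y) ->
  \forall y \near x, P (f y).
Proof. by move=> mf Wx; have [cf _ _ _] := mf x Wx; apply: cf. Qed.

(** * Differences of liftings, at germs and as sections *)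

Section LiftingProblem.
Variables (p : nat) (D : lifted_frobenius_twist p) (Om : differentials (X'S D)).
Variable Q : lifting_problem D.
Hypotheses (Q_red : reduction_mod p (inY Q)) (phi_mor : morphism (phi Q)).
Hypothesis Q_p2 : forall y : Y_ Q, (p ^ 2)%:R = 0 :> stalk (inY Q y).
Hypothesis Q_torsion :
  forall y : Y_ Q, p_torsion_multiple p (stalk (inY Q y)).

Local Notation base := (inX' D).
Local Notation tp y := (times_p p (@on_stalk _ _ (inY Q) y)).

Lemma inY_hom y : ring_hom (@on_stalk _ _ (inY Q) y).
Proof. by have [mi _ _ _ _] := Q_red; apply: morphism_stalk_hom. Qed.

Lemma inY_surj (y : Y_ Q) (b : stalk y) : exists a, on_stalk (r := inY Q) a = b.
Proof. by have [_ _ _ _ h] := Q_red; apply: (h y).1. Qed.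

Lemma inY_ker (y : Y_ Q) a :
  on_stalk (r := inY Q) (x := y) a = 0 <-> exists c, a = c *+ p.
Proof. by have [_ _ _ _ h] := Q_red; apply: (h y).2. Qed.

Lemma inX'_hom z : ring_hom (@on_stalk _ _ base z).
Proof. by have [mi _ _ _ _] := inX'_red D; apply: morphism_stalk_hom. Qed.

Lemma inX'_surj (z : X'_ D) (b : stalk z) : exists a, on_stalk (r := base) a = b.
Proof. by have [_ _ _ _ h] := inX'_red D; apply: (h z).1. Qed.

Lemma tpE y a : tp y (on_stalk a) = a *+ p.
Proof. exact: times_pE (inY_hom y).1 (mulrn_p2 (Q_p2 y)) (@inY_ker y) a. Qed.

Lemma tp_inj y : injective (tp y).
Proof.
exact: times_p_inj (inY_hom y).1 (mulrn_p2 (Q_p2 y)) (@inY_ker y)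
  (@inY_surj y) (@Q_torsion y).
Qed.

Lemma tpB y : zmod_morphism (tp y).
Proof.
exact: times_pB (inY_hom y).1 (mulrn_p2 (Q_p2 y)) (@inY_ker y) (@inY_surj y).
Qed.

(* The germ at y of the section G2 - G1 of phi^* T. *)
Definition difference_at (y : Y_ Q) (G1 G2 : raw_morphism (tY Q) (tX' D))
    (x : Om (phi Q y) -> stalk y) : Prop :=
  semilinear_form (@on_stalk _ _ (phi Q) y) x /\
  forall a : forall z : tX' D, stalk z,
    on_stalk (r := G2) (a (G2 (inY Q y))) - on_stalk (r := G1) (a (G1 (inY Q y)))
    = tp y (x (diff Om (on_stalk (a (base (phi Q y)))))).

Lemma lifting_difference_at W G1 G2 (xi : field_family Om Q) y :
  lifting_difference W G1 G2 xi -> W (inY Q y) -> difference_at G1 G2 (@xi y).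
Proof. by move=> [tan e] Wy; have [hxi _] := tan y Wy; split=> // a; apply: e. Qed.

(** Every germ on X' lifts to tX', so the characterization determines the form on all differentials
    da', by injectivity of [p]. *)
Lemma difference_at_uniq y G1 G2 (x x' : Om (phi Q y) -> stalk y) :
  difference_at G1 G2 x -> difference_at G1 G2 x' -> x =1 x'.
Proof.
move=> [hx ex] [hx' ex'].
apply: (kahler_form_ext (@diff_kahler _ _ _ Om (phi Q y)) hx hx') => a'.
have [a0 <-] := inX'_surj a'; have [a [_ <-]] := germ_ex a0.
by apply: tp_inj; rewrite -ex -ex'.
Qed.

Lemma difference_at_add y G1 G2 G3 (x x' : Om (phi Q y) -> stalk y) :
  difference_at G1 G2 x -> difference_at G2 G3 x' ->
  difference_at G1 G3 (fun m => x m + x' m).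
Proof.
move=> [[xB xZ] ex] [[x'B x'Z] ex']; split.
  split=> [m m'|a m]; last by rewrite xZ x'Z mulrDr.
  by rewrite xB x'B opprD addrACA.
by move=> a; rewrite (zmod_morphismD (@tpB y)) -ex -ex' [RHS]addrC [RHS]addrA subrK.
Qed.

Lemma difference_at_eqr W y G1 G2 G2' (x : Om (phi Q y) -> stalk y) :
  eq_mor_on W G2 G2' -> W (inY Q y) ->
  difference_at G1 G2 x -> difference_at G1 G2' x.
Proof.
by move=> e Wy [hx ex]; split=> // a; rewrite -ex; have [_ ->] := e _ Wy.
Qed.

Lemma lifting_point W G y : lifting (Q := Q) W G -> W (inY Q y) ->
  G (inY Q y) = base (phi Q y).
Proof. by move=> [_ _ _ e] Wy; have [] := e y Wy. Qed.

Lemma lifting_restrict W W' G : lifting (Q := Q) W G -> open W' -> W' `<=` W ->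
  lifting (Q := Q) W' G.
Proof.
move=> [_ mG eS e] oW' sW; split=> //.
- by move=> y /sW; apply: mG.
- by move=> y /sW; apply: eS.
- by move=> y /sW; apply: e.
Qed.

Lemma difference_at_ex W G1 G2 y : lifting (Q := Q) W G1 ->
  lifting (Q := Q) W G2 -> W (inY Q y) -> exists x, difference_at (y := y) G1 G2 x.
Proof.
move=> l1 l2 Wy; have e1 := lifting_point l1 Wy; have e2 := lifting_point l2 Wy.
have [_ m1 s1 r1] := l1; have [_ m2 s2 r2] := l2.
have red (G : raw_morphism (tY Q) (tX' D)) (e : G (inY Q y) = base (phi Q y)) :
    eq_mor_on (inY Q @^-1` W) (mor_comp G (inY Q)) (mor_comp base (phi Q)) ->
    forall a, on_stalk (r := inY Q) (stalk_map e a) =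
      on_stalk (r := phi Q) (on_stalk (r := base) a).
  move=> r a0; have [a [_ <-]] := germ_ex a0; rewrite stalk_mapE.
  by have [_ E] := r y Wy; apply: E.
have hg1 : ring_hom (stalk_map e1) by apply: stalk_map_hom; have [] := m1 _ Wy.
have hg2 : ring_hom (stalk_map e2) by apply: stalk_map_hom; have [] := m2 _ Wy.
have ker (a : stalk (base (phi Q y))) :
    on_stalk (r := base) a = 0 -> exists c, a = c *+ p.
  by have [_ _ _ _ h] := inX'_red D => /((h _).2 a).
(* A function coming from S lifts to one coming from tS, where two tS-morphisms have the same
   pullback. *)
have bs (c : stalk (X'S D (phi Q y))) : exists a,
    on_stalk (r := base) a = on_stalk (r := X'S D) c /\
    stalk_map e1 a = stalk_map e2 a.
  have [_ _ _ _ h] := inS_red D.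
  have [b0 <-] := (h (X'S D (phi Q y))).1 c; have [b [_ <-]] := germ_ex b0.
  pose a z := on_stalk (r := tX'S D) (x := z) (b (tX'S D z)).
  exists (a (base (phi Q y))); split.
    by have [_ E] := inX'_S D (phi Q y) I; apply: E.
  rewrite !stalk_mapE.
  have [_ E1] := s1 _ Wy; have [_ E2] := s2 _ Wy.
  by rewrite [LHS](E1 b) [RHS](E2 b).
have [x [hx ex]] := difference_form (@diff_kahler _ _ _ Om (phi Q y))
  (inX'_hom (phi Q y)) (inY_hom y) hg1 hg2 (morphism_stalk_hom y phi_mor)
  (red _ e1 r1) (red _ e2 r2) (@inX'_surj _) (@inY_surj y) ker
  (@inY_ker y) (Q_p2 y) (@Q_torsion y) bs.
by exists x; split=> // a; rewrite -ex !stalk_mapE.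
Qed.

Lemma regular_difference W G1 G2 y (b : forall z : tX' D, stalk z) :
  lifting (Q := Q) W G1 -> lifting (Q := Q) W G2 -> W (inY Q y) ->
  regular b (base (phi Q y)) ->
  regular (fun u => on_stalk (r := G2) (b (G2 u)) -
                    on_stalk (r := G1) (b (G1 u))) (inY Q y).
Proof.
move=> l1 l2 Wy rb; have e1 := lifting_point l1 Wy; have e2 := lifting_point l2 Wy.
have [_ m1 _ _] := l1; have [_ m2 _ _] := l2.
have [_ _ _ R1] := m1 _ Wy; have [_ _ _ R2] := m2 _ Wy.
by apply: regularB; [apply: R2; rewrite e2|apply: R1; rewrite e1].
Qed.

(** The germs are chosen point by point, so regularity needs an argument: near a point, [p] xi(da')
    is a difference of two regular functions, and dividing it by p can be done by a regular
    function. *)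
Lemma lifting_difference_ex W G1 G2 : lifting (Q := Q) W G1 ->
  lifting (Q := Q) W G2 ->
  exists xi : field_family Om Q, lifting_difference W G1 G2 xi.
Proof.
move=> l1 l2.
have ex y : exists x : Om (phi Q y) -> stalk y,
    W (inY Q y) -> difference_at G1 G2 x.
  have [Wy|nWy] := pselect (W (inY Q y)); last by exists (fun=> 0).
  by have [x hx] := difference_at_ex l1 l2 Wy; exists x.
pose xi : field_family Om Q := fun y => sval (cid (ex y)).
have xiP y : W (inY Q y) -> difference_at G1 G2 (@xi y) := svalP (cid (ex y)).
exists xi; split; last by move=> y /xiP[].
have [mi _ _ _ _] := Q_red; have [oW _ _ _] := l1.
have nearW y : W (inY Q y) -> \forall z \near y, W (inY Q z).
  move=> Wy; apply: (morphism_near (P := W) mi (x := y)) => //.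
  exact: open_nbhs_nbhs.
move=> y Wy; split; first by case: (xiP y Wy).
(* One regular extension of each germ suffices, because regular families with the same value at a
   point agree nearby. Such germs form a submodule, which leaves the case of a differential. *)
pose P (m : Om (phi Q y)) := exists s : forall z, Om z,
  [/\ mregular s (phi Q y), s (phi Q y) = m &
      regular (fun z => xi z (s (phi Q z))) y].
have allP m : P m.
  move: m; apply: (kahler_ind (@diff_kahler _ _ _ Om (phi Q y))).
    split.
    - exists (fun=> 0); split=> //; first exact: mregular0.
      apply: regular_transfer (regular0 y) _.
      apply: filterS (nearW y Wy) => z /xiP[[xB _] _].
      by rewrite (zmod_morphism0 xB).
    - move=> _ _ [s [rs <- xs]] [t [rt <- xt]].
      exists (fun z => s z + t z); split=> //; first exact: mregularD.
      apply: regular_transfer (regularD xs xt) _.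
      apply: filterS (nearW y Wy) => z /xiP[[xB _] _].
      by rewrite (zmod_morphismD xB).
    - move=> a0 _ [s [rs <- xs]]; have [a [ra <-]] := germ_ex a0.
      exists (fun z => a z *: s z); split=> //; first exact: mregularZ.
      have [_ _ _ rphi] := phi_mor (x := y) I.
      apply: regular_transfer (regularM (rphi _ ra) xs) _.
      apply: filterS (nearW y Wy) => z /xiP[[_ xZ] _].
      by rewrite xZ.
  move=> a'; have [a0 <-] := inX'_surj a'; have [b [rb <-]] := germ_ex a0.
  exists (fun z => diff Om (on_stalk (r := base) (b (base z)))); split=> //.
    apply: diff_regular; have [mb _ _ _ _] := inX'_red D.
    by have [_ _ _] := mb (phi Q y) I; apply.
  have re := regular_difference l1 l2 Wy rb.
  set e1 := fun u => _ in re.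
  have /inY_ker[c0 ec] : on_stalk (r := inY Q) (e1 (inY Q y)) = 0.
    have [_ xe] := xiP y Wy; rewrite /e1 xe.
    have [c <-] := inY_surj (xi y (diff Om (on_stalk (r := base) (b (base (phi Q y)))))).
    by rewrite tpE; apply/inY_ker; exists c.
  have [c [rc ec0]] := germ_ex c0; rewrite -ec0 in ec.
  (* The equality e1 = p c at the point spreads to a neighbourhood; there injectivity of [p]
     identifies xi(da') with the reduction of [c]. *)
  have ne := regular_near_eq re (regularMn p rc) ec.
  have [_ _ _ ri] := mi y I.
  apply: regular_transfer (ri _ rc) _.
  have ne' := morphism_near mi I ne.
  apply: filterS2 ne' (nearW y Wy) => z ez /xiP[_ xe].
  by apply: tp_inj; rewrite tpE -xe -ez.
move=> w rw; have [s [rs es xs]] := allP (w (phi Q y)).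
apply: regular_transfer xs _.
apply: filterS (morphism_near phi_mor I (mregular_near_eq rs rw es)) => z ->.
by [].
Qed.

(** A difference known only at the germ determines the value, whatever open set and section [xget]
    has picked. *)
Lemma splitting_value (F G : raw_morphism (tY Q) (tX' D)) W y
    (w : forall z : X'_ D, Om z) (x : Om (phi Q y) -> stalk y) :
  lifting (Q := Q) W F -> lifting (Q := Q) W G -> W (inY Q y) ->
  difference_at F G x ->
  value (splitting F (one_tensor w)) G y = x (w (phi Q y)).
Proof.
move=> lF lG Wy hx.
have pairE (x' : Om (phi Q y) -> stalk y) :
    pairing (one_tensor w y) x' = x' (w (phi Q y)).
  by rewrite /pairing /one_tensor big_seq1 mul1r.
apply: xget_unique.
  have [xi hxi] := lifting_difference_ex lF lG; exists W, xi; split=> //.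
  by rewrite pairE; apply: difference_at_uniq hx (lifting_difference_at hxi Wy) _.
move=> _ [W' [xi [W'y _ _ hxi ->]]]; rewrite pairE.
exact: difference_at_uniq (lifting_difference_at hxi W'y) hx _.
Qed.

(** The affine law is the cocycle relation G2 - F = (G1 - F) + (G2 - G1). *)
Lemma splitting_affine (F : raw_morphism (tY Q) (tX' D)) (V' : set (X'_ D))
    (w : forall z : X'_ D, Om z) :
  lifting (Q := Q) setT F -> (forall z, V' z -> mregular w z) ->
  affine_function (Q := Q) (phi Q @^-1` V') (splitting F (one_tensor w)).
Proof.
move=> lF rw.
have lFW W G : lifting (Q := Q) W G -> lifting (Q := Q) W F.
  by move=> [oW _ _ _]; apply: lifting_restrict lF oW _.
split=> [y Vy|W G lG y Vy Wy|W G G' lG lG' eG y Vy Wy|W G1 G2 xi l1 l2 hxi y Vy Wy].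
- exists [:: (fun=> 1, w)]; split=> [[|//] _ /=|].
    by split; [exact: regular1|exact: rw].
  exact: nearW.
- have lFG := lFW _ _ lG; have [xi hxi] := lifting_difference_ex lFG lG.
  have [tan _] := hxi; have [_ /(_ w (rw _ Vy)) rxi] := tan y Wy.
  apply: regular_transfer rxi _.
  have [mi _ _ _ _] := Q_red; have [oW _ _ _] := lG.
  have nW : \forall z \near y, W (inY Q z).
    apply: (morphism_near (P := W) mi (x := y)) => //.
    exact: open_nbhs_nbhs.
  apply: filterS nW => z Wz; apply/esym.
  exact: splitting_value lFG lG Wz (lifting_difference_at hxi Wz).
- have lFG := lFW _ _ lG; have [x hx] := difference_at_ex lFG lG Wy.
  rewrite (splitting_value w lFG lG Wy hx).
  by rewrite (splitting_value w lFG lG' Wy (difference_at_eqr eG Wy hx)).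
- have lF1 := lFW _ _ l1; have [x hx] := difference_at_ex lF1 l1 Wy.
  have hxi' := lifting_difference_at hxi Wy.
  rewrite (splitting_value w lF1 l1 Wy hx).
  rewrite (splitting_value w lF1 l2 Wy (difference_at_add hx hxi')).
  by rewrite /pairing /= /one_tensor big_seq1 mul1r.
Qed.

End LiftingProblem.

(** * The connection *)

Lemma diff_pull_semilinear (X X' Y Y' : ringed_space) (g : raw_morphism X Y)
    (g' : raw_morphism X' Y') (Om : differentials g) (Om' : differentials g')
    (f : raw_morphism X X') (x : X) :
  ring_hom (@on_stalk _ _ f x) ->
  (forall c, exists c0 : stalk (g x),
     on_stalk (r := f) (on_stalk (r := g') c) = on_stalk (r := g) c0) ->
  exists th : Om' (f x) -> Om x, [/\ semilinear (@on_stalk _ _ f x) th,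
    forall a, th (diff Om' a) = diff Om (on_stalk a) &
    forall w, diff_pull Om w = th w].
Proof.
move=> hf base; have [k0 k0P] := choice base.
have [th [hth thd]] := kahler_map (@diff_kahler _ _ _ Om' (f x))
  (@diff_kahler _ _ _ Om x) hf k0P.
exists th; split=> // w; apply: xget_unique; first by exists th.
move=> _ [th' [hth' thd' ->]].
apply: (kahler_ext (@diff_kahler _ _ _ Om' (f x)) hth' hth) => a.
by rewrite thd' thd.
Qed.

(** Moves a linear form to a provably equal point; evaluation on families keeps the transport out of
    the conclusion. *)
Lemma semilinear_form_transport (X : ringed_space) (M : module_sheaf X)
    (z z' : X) (B : comPzRingType) (x : M z -> B) (f : stalk z -> B)
    (f' : stalk z' -> B) : z = z' ->
  (forall a : forall u : X, stalk u, f (a z) = f' (a z')) ->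
  semilinear_form f x ->
  exists x' : M z' -> B, semilinear_form f' x' /\
    forall w : forall u, M u, x' (w z') = x (w z).
Proof.
move=> e; case: z' / e f' => f' ff' hx; exists x; split=> //.
suff -> : f' = f by [].
by apply/funext => r; have [a [_ <-]] := germ_ex r.
Qed.

Section Conclusion.
Variables (p : nat) (p_prime : prime p) (D : lifted_frobenius_twist p).
Variables (L : lifted_open D) (N : diagonal_neighborhood L).

Lemma relFU_mor : morphism (relFU L).
Proof. by have [mu _ _ _] := UX_open L; apply: (morphism_comp (relF_mor D) mu). Qed.

Lemma US_mor : morphism (US L).
Proof. by have [mu _ _ _] := UX_open L; apply: (morphism_comp (XS_mor D) mu). Qed.

Lemma inU_th1 (t : T_ N) : inU L (h1 N t) = th1 N (inT N t).
Proof. by have [] := h1_red N t I. Qed.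

Lemma inU_th2 (t : T_ N) : inU L (h2 N t) = th2 N (inT N t).
Proof. by have [] := h2_red N t I. Qed.

Lemma h12 (t : T_ N) : h2 N t = h1 N t.
Proof.
have [_ inj _ _ _] := inU_red L; apply: inj.
by rewrite inU_th1 inU_th2 th12.
Qed.

Lemma h1_stalk (t : T_ N) (b : forall u : tU L, stalk u) :
  on_stalk (r := h1 N) (on_stalk (r := inU L) (b (inU L (h1 N t)))) =
  on_stalk (r := inT N) (on_stalk (r := th1 N) (b (th1 N (inT N t)))).
Proof. by have [_ E] := h1_red N t I; apply: E. Qed.

Lemma h2_stalk (t : T_ N) (b : forall u : tU L, stalk u) :
  on_stalk (r := h2 N) (on_stalk (r := inU L) (b (inU L (h2 N t)))) =
  on_stalk (r := inT N) (on_stalk (r := th2 N) (b (th2 N (inT N t)))).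
Proof. by have [_ E] := h2_red N t I; apply: E. Qed.

Lemma inT_hom t : ring_hom (@on_stalk _ _ (inT N) t).
Proof. by have [mi _ _ _ _] := inT_red N; apply: morphism_stalk_hom. Qed.

Lemma lift_family (t : T_ N) (b : forall u : U_ L, stalk u) :
  exists c : forall u : tU L, stalk u,
    b (h1 N t) = on_stalk (r := inU L) (c (inU L (h1 N t))) /\
    b (h2 N t) = on_stalk (r := inU L) (c (inU L (h2 N t))).
Proof.
have [_ _ _ _ h] := inU_red L; have [c0 e0] := (h (h1 N t)).1 (b (h1 N t)).
have [c [_ ec]] := germ_ex c0; exists c; rewrite h12.
by rewrite ec e0.
Qed.

Lemma h_square_zero (t : T_ N) (a b : forall u : U_ L, stalk u) :
  (on_stalk (r := h2 N) (a (h2 N t)) - on_stalk (r := h1 N) (a (h1 N t))) *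
  (on_stalk (r := h2 N) (b (h2 N t)) - on_stalk (r := h1 N) (b (h1 N t))) = 0.
Proof.
have [c [-> ->]] := lift_family t a; have [d [-> ->]] := lift_family t b.
rewrite !h1_stalk !h2_stalk -!(ring_homB (inT_hom t)) -(ring_homM (inT_hom t)).
by rewrite th_square_zero (ring_hom0 (inT_hom t)).
Qed.

Lemma tUS_th (y : tT N) : tUS L (th1 N y) = tUS L (th2 N y) /\
  forall s : forall v : tS D, stalk v,
    on_stalk (r := th1 N) (on_stalk (r := tUS L) (s (tUS L (th1 N y)))) =
    on_stalk (r := th2 N) (on_stalk (r := tUS L) (s (tUS L (th2 N y)))).
Proof.
have [_ _ _ pfg _] := tP_product N; have [e E] := pfg (tTP N y) I.
by split=> // s; congr (on_stalk (r := tTP N)); apply: E.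
Qed.

(** A function from S is lifted to tS, where the two pullbacks to tT agree because tT maps to the
    product over tS; then one reduces. *)
Lemma US_h (t : T_ N) : US L (h2 N t) = US L (h1 N t) /\
  forall s : forall v : S_ D, stalk v,
    on_stalk (r := h2 N) (on_stalk (r := US L) (s (US L (h2 N t)))) =
    on_stalk (r := h1 N) (on_stalk (r := US L) (s (US L (h1 N t)))).
Proof.
split=> [|s]; first by rewrite h12.
have [_ _ _ _ h] := inS_red D.
have [c0 e0] := (h (US L (h1 N t))).1 (s (US L (h1 N t))).
have [c [_ ec]] := germ_ex c0; rewrite -ec in e0.
have e0' : on_stalk (r := inS D) (c (inS D (US L (h2 N t)))) = s (US L (h2 N t)).
  by rewrite h12.
pose b u := on_stalk (r := tUS L) (x := u) (c (tUS L u)).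
have lift u : on_stalk (r := US L) (x := u)
    (on_stalk (r := inS D) (c (inS D (US L u)))) =
    on_stalk (r := inU L) (b (inU L u)).
  by have [_ E] := inU_S L u I; apply/esym/E.
rewrite -e0 -e0' !lift h1_stalk h2_stalk; congr on_stalk.
by have [_ E] := tUS_th (inT N t); apply/esym/E.
Qed.

Lemma T_char (t : T_ N) : p%:R = 0 :> stalk t.
Proof.
apply: (nat_stalk_map (h1_mor N) (x := t)).
exact: nat_stalk_map US_mor (char_p _).
Qed.

(** First-order Taylor expansion: x^n - y^n = n y^(n-1) (x - y) when (x - y)^2 = 0. *)
Lemma expr_square_zero (R : comPzRingType) (x y : R) n :
  (x - y) * (x - y) = 0 -> n%:R = 0 :> R -> x ^+ n = y ^+ n.
Proof.
move=> xy n0.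
have aux m : x ^+ m.+1 = y ^+ m.+1 + m.+1%:R * (y ^+ m * (x - y)).
  elim: m => [|m IH]; first by rewrite !expr1 expr0; ring.
  rewrite exprS IH (exprS y m.+1) (exprS y m) (mulrS 1 m.+1).
  move: (y ^+ m) (m.+1%:R : R) => u v; apply/eqP; rewrite -subr_eq0; apply/eqP.
  transitivity (v * u * ((x - y) * (x - y))); first by ring.
  by rewrite xy mulr0.
case: n n0 => [|m] m0; first by rewrite !expr0.
by rewrite aux m0 mul0r addr0.
Qed.

(* Both composites lift the absolute Frobenius of T, which does not see the
   square-zero difference of h1 and h2. *)
Lemma relFU_h12 : eq_mor (mor_comp (relFU L) (h2 N)) (mor_comp (relFU L) (h1 N)).
Proof.
have [_ mX mS pfg] := X'_product D.
have m1 := morphism_comp relFU_mor (h1_mor N) (fun _ _ => I).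
have m2 := morphism_comp relFU_mor (h2_mor N) (fun _ _ => I).
move=> /(_ (T_ N) (mor_comp (X'X D) (mor_comp (relFU L) (h1 N)))
  (mor_comp (X'S D) (mor_comp (relFU L) (h1 N)))) [].
- exact: scheme_locally_ringed (T_scheme N).
- exact: (morphism_comp mX m1).
- exact: (morphism_comp mS m1).
- move=> t _; have [e E] := pfg (relFU L (h1 N t)) I; split=> [|s]; first exact: e.
  by congr (on_stalk (r := h1 N) (on_stalk (r := relFU L) _)); apply: E.
move=> _ uniq; apply: uniq; split=> //.
- move=> t _; split=> [|s]; first by rewrite /= h12.
  pose b u := on_stalk (r := UX L) (x := u) (s (UX L u)).
  have [mu _ _ _] := UX_open L.
  have aux u : on_stalk (r := relFU L) (x := u)
      (on_stalk (r := X'X D) (s (X'X D (relFU L u)))) = b u ^+ p.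
    have [_ E] := relF_X D (UX L u) I.
    rewrite /b -(ring_homX (morphism_stalk_hom u mu)).
    by congr (on_stalk (r := UX L)); apply: E.
  rewrite /= [X in on_stalk X = _](aux (h2 N t)) [X in _ = on_stalk X](aux (h1 N t)).
  rewrite (ring_homX (morphism_stalk_hom t (h1_mor N))).
  rewrite (ring_homX (morphism_stalk_hom t (h2_mor N))).
  by apply: expr_square_zero; [exact: h_square_zero|exact: T_char].
- move=> t _; split=> [|s]; first by rewrite /= h12.
  have aux u : on_stalk (r := relFU L) (x := u)
      (on_stalk (r := X'S D) (s (X'S D (relFU L u)))) =
      on_stalk (r := US L) (s (US L u)).
    have [_ E] := relF_S D (UX L u) I.
    by congr (on_stalk (r := UX L)); apply: E.
  rewrite /= [X in on_stalk X = _](aux (h2 N t)) [X in _ = on_stalk X](aux (h1 N t)).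
  by have [_ E] := US_h t; apply: E.
Qed.

Variables (Om : differentials (X'S D)) (OmU : differentials (US L)).
Variables (OmtX' : differentials (tX'S D)) (OmtU : differentials (tUS L)).
Local Notation QU := (liftings_U L).
Local Notation QT := (liftings_T N).

Lemma phiT_mor : morphism (phi QT).
Proof. exact: (morphism_comp relFU_mor (h1_mor N)). Qed.

(** * Pullback of liftings and of splittings along h1 and h2 *)

Section Pull.
Variables (h : raw_morphism (T_ N) (U_ L)) (th : raw_morphism (tT N) (tU L)).
Hypotheses (h_mor : morphism h) (th_mor : morphism th).
Hypothesis h_red : eq_mor (mor_comp (inU L) h) (mor_comp th (inT N)).
Hypothesis h_phi :
  eq_mor (mor_comp (relFU L) h) (mor_comp (relFU L) (h1 N)).
Hypothesis th_base :
  eq_mor (mor_comp (tUS L) th) (mor_comp (tUS L) (th1 N)).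

(** If the two pullbacks differ by p c on tU, they differ by p th^* c on tT, so division by p
    commutes with pullback. [h_phi] is needed because [liftings_T] is defined through [h1], also
    when [h] is [h2]. *)
Lemma pull_difference (t : T_ N) F G0 (x : Om (relFU L (h t)) -> stalk (h t)) :
  difference_at (Q := QU) F G0 x ->
  exists x' : Om (phi QT t) -> stalk t,
    difference_at (Q := QT) (mor_comp F th) (mor_comp G0 th) x' /\
    forall w : forall z, Om z,
      x' (w (phi QT t)) = on_stalk (r := h) (x (w (relFU L (h t)))).
Proof.
move=> [[xB xZ] xd]; have hh := morphism_stalk_hom t h_mor.
have hth := morphism_stalk_hom (inT N t) th_mor.
have [e E] := h_phi (x := t) I.
have [||x' [hx' x'E]] := semilinear_form_transport (M := Om)
  (x := fun m => on_stalk (r := h) (x m))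
  (f := fun a => on_stalk (r := h) (on_stalk (r := relFU L) a))
  (f' := @on_stalk _ _ (phi QT) t) e.
- exact: E.
- split=> [m m'|a m]; first by rewrite xB (ring_homB hh).
  by rewrite xZ (ring_homM hh).
exists x'; split=> //; split=> // a.
pose b u := on_stalk (r := G0) (x := u) (a (G0 u)) -
  on_stalk (r := F) (x := u) (a (F u)).
pose w z := diff Om (on_stalk (r := inX' D) (x := z) (a (inX' D z))).
have [c0 ec0] := inY_surj (Q := QU) (inU_red L) (x (w (relFU L (h t)))).
have [c [_ ec]] := germ_ex c0; rewrite -ec in ec0.
have bc : b (inU L (h t)) = c (inU L (h t)) *+ p.
  rewrite /b (xd a) -[X in times_p p _ X]ec0.
  by rewrite (tpE (Q := QU) (inU_red L) (fun y => tU_p2 (inU L y))).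
have [pe pE] := h_red (x := t) I.
have bc' : b (th (inT N t)) = c (th (inT N t)) *+ p by move: bc; rewrite [inU L (h t)]pe.
rewrite /= -[LHS](ring_homB hth) -/(b (th (inT N t))) bc' (ring_homMn hth).
rewrite -(tpE (Q := QT) (inT_red N) (fun y => tT_p2 (inT N y))).
congr times_p; rewrite -[diff Om _]/(w (phi QT t)) x'E -ec0.
exact/esym/(pE c).
Qed.

Lemma lifting_pull F : lifting (Q := QU) setT F ->
  lifting (Q := QT) setT (mor_comp F th).
Proof.
move=> [_ mF sF rF]; split.
- exact: openT.
- exact: (morphism_comp mF th_mor).
- move=> y _; have [e E] := sF (th y) I; have [e' E'] := th_base (x := y) I.
  split=> [|s]; first by rewrite /= -[RHS]e' -[RHS]e.
  rewrite -[RHS]E'; congr (on_stalk (r := th)); exact: E.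
- move=> t _; have [pe pE] := h_red (x := t) I; have [e E] := h_phi (x := t) I.
  have [e1 E1] := rF (h t) I.
  split=> [|a].
    exact: etrans (congr1 F (esym pe)) (etrans e1 (congr1 (inX' D) e)).
  pose b u := on_stalk (r := F) (x := u) (a (F u)).
  pose a' z := on_stalk (r := inX' D) (x := z) (a (inX' D z)).
  rewrite -[LHS](pE b) -[RHS](E a'); congr (on_stalk (r := h)).
  exact: E1.
Qed.

(** The auxiliary lifting G0 cancels: the two terms are the values at [w] of G0 \o th - F \o th and
    of G - G0 \o th, whose sum is G - F \o th. *)
Lemma pull_value F (w : forall z, Om z) W G t (x : Om (phi QT t) -> stalk t) :
  lifting (Q := QU) setT F -> lifting (Q := QT) W G -> W (inT N t) ->
  difference_at (Q := QT) (mor_comp F th) G x ->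
  value (torsor_function_pull h th (splitting (Q := QU) F (one_tensor w))) G t =
    x (w (phi QT t)).
Proof.
move=> lF lG Wt hx.
have hh := morphism_stalk_hom t h_mor.
have elt (W0 : set (tU L)) G0 W1 (xi : field_family Om QT) :
    lifting (Q := QU) W0 G0 -> W1 (inT N t) -> W1 `<=` th @^-1` W0 ->
    lifting_difference (Q := QT) W1 (mor_comp G0 th) G xi ->
    on_stalk (r := h) (value (splitting (Q := QU) F (one_tensor w)) G0 (h t)) +
      pairing [seq (on_stalk (r := h) c.1, c.2)
              | c <- one_tensor (Q := QU) w (h t)] (@xi t)
    = x (w (phi QT t)).
  move=> lG0 Wt1 sub hxi.
  have lFW : lifting (Q := QU) W0 F.
    by have [oW _ _ _] := lG0; apply: lifting_restrict lF oW _.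
  have W0h : W0 (inU L (h t)).
    by have [e _] := h_red (x := t) I; rewrite [inU L (h t)]e; apply: sub.
  have [x0 hx0] := difference_at_ex (Q := QU) Om (inU_red L) relFU_mor
    (fun y => tU_p2 (inU L y)) (fun y => @tU_torsion _ p_prime _ L (inU L y))
    lFW lG0 W0h.
  rewrite (splitting_value (Q := QU) (inU_red L) relFU_mor (fun y => tU_p2 (inU L y))
    (fun y => @tU_torsion _ p_prime _ L (inU L y)) w lFW lG0 W0h hx0).
  have [x' [hx' x'E]] := pull_difference hx0.
  rewrite /pairing /= big_seq1 /= (ring_hom1 hh) mul1r -x'E.
  have hxi' := lifting_difference_at hxi Wt1.
  have hsum := difference_at_add (Q := QT) (inT_red N)
    (fun y => tT_p2 (inT N y)) hx' hxi'.
  exact: (difference_at_uniq (Q := QT) (inT_red N) (fun y => tT_p2 (inT N y))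
    (fun y => @tT_torsion _ p_prime _ L N OmtU (inT N y)) hsum hx).
apply: xget_unique; last first.
  by move=> _ [W0 [G0 [W1 [xi [lG0 [Wt1 sub] _ hxi ->]]]]]; exact: elt lG0 Wt1 sub hxi.
have lFT : lifting (Q := QT) W (mor_comp F th).
  have [oW _ _ _] := lG.
  exact: (lifting_restrict (Q := QT) (lifting_pull lF) oW (fun _ _ => I)).
have [xi hxi] := lifting_difference_ex (Q := QT) Om (inT_red N) phiT_mor
  (fun y => tT_p2 (inT N y))
  (fun y => @tT_torsion _ p_prime _ L N OmtU (inT N y)) lFT lG.
(* For the existence of a value, [F] itself serves as the auxiliary lifting, on all of tU. *)
by exists setT, F, W, xi; split=> //; apply/esym/(elt _ _ _ _ lF Wt _ hxi).
Qed.

End Pull.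

(** The difference of the pullbacks by [h2] and [h1] is a derivation because products of two such
    differences vanish on T, and it kills functions from S by [US_h]. *)
Lemma differential_in_T_form (t : T_ N) : exists dT : OmU (h1 N t) -> stalk t,
  [/\ semilinear_form (@on_stalk _ _ (h1 N) t) dT,
      forall a : forall u : U_ L, stalk u, dT (diff OmU (a (h1 N t))) =
        on_stalk (r := h2 N) (a (h2 N t)) - on_stalk (r := h1 N) (a (h1 N t)) &
      forall w, differential_in_T w = dT w].
Proof.
pose s2 : stalk (h1 N t) -> stalk t := stalk_map (h12 t).
have hh1 := morphism_stalk_hom t (h1_mor N).
have hs2 : ring_hom s2 by apply/stalk_map_hom/morphism_stalk_hom/h2_mor.
have s2E (a : forall u : U_ L, stalk u) :
    s2 (a (h1 N t)) = on_stalk (r := h2 N) (a (h2 N t)).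
  exact: stalk_mapE.
have [||||dT [hdT dTd]] := kahler_form_lift (@diff_kahler _ _ _ OmU (h1 N t))
  (f := @on_stalk _ _ (h1 N) t) (D := fun r => s2 r - on_stalk (r := h1 N) r).
- exact: hh1.
- by move=> a b; rewrite (ring_homB hs2) (ring_homB hh1); ring.
- move=> a0 b0; have [a [_ <-]] := germ_ex a0; have [b [_ <-]] := germ_ex b0.
  have := h_square_zero t a b.
  rewrite -!s2E (ring_homM hs2) (ring_homM hh1) => ab0.
  by apply/eqP; rewrite -subr_eq0; apply/eqP; rewrite -[RHS]ab0; ring.
- move=> c0; have [c [_ <-]] := germ_ex c0.
  pose b u := on_stalk (r := US L) (x := u) (c (US L u)).
  rewrite -[on_stalk _]/(b (h1 N t)) s2E.
  by have [_ E] := US_h t; rewrite [X in X - _]E subrr.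
have dTa (a : forall u : U_ L, stalk u) : dT (diff OmU (a (h1 N t))) =
    on_stalk (r := h2 N) (a (h2 N t)) - on_stalk (r := h1 N) (a (h1 N t)).
  by rewrite dTd s2E.
exists dT; split=> // w; apply: xget_unique; first by exists dT.
move=> _ [dT' [hdT' dTa' ->]].
apply: (kahler_form_ext (@diff_kahler _ _ _ OmU (h1 N t)) hdT' hdT) => a0.
by have [a [_ <-]] := germ_ex a0; rewrite dTa' dTa.
Qed.

Lemma diff_pull_F F u : lifting (Q := QU) setT F ->
  exists thF : OmtX' (F u) -> OmtU u, [/\ semilinear (@on_stalk _ _ F u) thF,
    forall a, thF (diff OmtX' a) = diff OmtU (on_stalk a) &
    forall w, diff_pull OmtU w = thF w].
Proof.
move=> [_ mF sF _]; apply: diff_pull_semilinear; first exact: morphism_stalk_hom.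
move=> c0; have [c [_ <-]] := germ_ex c0; exists (c (tUS L u)).
by have [_ E] := sF u I; apply: E.
Qed.

Lemma diff_pull_inX' z : exists thX : OmtX' (inX' D z) -> Om z,
  [/\ semilinear (@on_stalk _ _ (inX' D) z) thX,
    forall a, thX (diff OmtX' a) = diff Om (on_stalk a) &
    forall w, diff_pull Om w = thX w].
Proof.
apply: diff_pull_semilinear; first exact: inX'_hom.
move=> c0; have [c [_ <-]] := germ_ex c0.
exists (on_stalk (r := inS D) (c (inS D (X'S D z)))).
by have [_ E] := inX'_S D z I; apply: E.
Qed.

Lemma diff_pull_inU u : exists thU : OmtU (inU L u) -> OmU u,
  [/\ semilinear (@on_stalk _ _ (inU L) u) thU,
    forall a, thU (diff OmtU a) = diff OmU (on_stalk a) &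
    forall w, diff_pull OmU w = thU w].
Proof.
apply: diff_pull_semilinear; first exact: (inY_hom (Q := QU) (inU_red L)).
move=> c0; have [c [_ <-]] := germ_ex c0.
exists (on_stalk (r := inS D) (c (inS D (US L u)))).
by have [_ E] := inU_S L u I; apply: E.
Qed.

Lemma divided_differential_lift F zeta u (a : forall z : tX' D, stalk z) :
  lifting (Q := QU) setT F -> is_divided_differential OmtX' OmtU F zeta ->
  exists al : OmtU (inU L u),
    diff_pull OmU al =
      zeta u (diff Om (on_stalk (r := inX' D) (a (inX' D (relFU L u))))) /\
    diff OmtU (on_stalk (r := F) (a (F (inU L u)))) = al *+ p.
Proof.
move=> lF zetaP; have [_ _ ] := zetaP u.
move=> /(_ (fun z => diff OmtX' (a z))).
have [thF [_ thFd ->]] := diff_pull_F (inU L u) lF; rewrite thFd => ->.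
have [thX [_ thXd ->]] := diff_pull_inX' (relFU L u); rewrite thXd.
set m := zeta u _; rewrite /times_p.
have [thU [hthU thUd thUE]] := diff_pull_inU u.
have [al eal] := kahler_map_surj (@diff_kahler _ _ _ OmU u) hthU thUd
  (@inY_surj _ _ QU (inU_red L) u) m.
(* The set defining [times_p] is nonempty because differentials of U lift to tU; [xgetI] then
   returns a lifting whose multiple by p is the chosen value. *)
have : [set c | exists al, diff_pull OmU (f := inU L) (x := u) al = m /\
    c = al *+ p :> OmtU (inU L u)] (al *+ p).
  by exists al; rewrite thUE.
by move=> /(xgetI 0)[al' [e1 e2]]; exists al'.
Qed.

(* [p] d_T(zeta(da')) and th2^* (F^* a) - th1^* (F^* a) are both p times the
   image in O_tT of any lifting to tU of the form zeta(da'). *)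
Lemma zeta_difference F zeta (t : T_ N) (dT : OmU (h1 N t) -> stalk t) :
  lifting (Q := QU) setT F -> is_divided_differential OmtX' OmtU F zeta ->
  semilinear_form (@on_stalk _ _ (h1 N) t) dT ->
  (forall a : forall u : U_ L, stalk u, dT (diff OmU (a (h1 N t))) =
     on_stalk (r := h2 N) (a (h2 N t)) - on_stalk (r := h1 N) (a (h1 N t))) ->
  difference_at (Q := QT) (mor_comp F (th1 N)) (mor_comp F (th2 N))
    (fun m : Om (phi QT t) => dT (zeta (h1 N t) m)).
Proof.
move=> lF zetaP [dTB dTZ] dTa; have [[zB zZ] _ _] := zetaP (h1 N t); split.
  by split=> [m m'|a m]; [rewrite zB dTB|rewrite zZ dTZ].
move=> a; have [al [eal ed]] := divided_differential_lift (h1 N t) a lF zetaP.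
have [thU [[thUB thUZ] thUd thUE]] := diff_pull_inU (h1 N t).
have [v0 [hv0 v0d]] := th_differential OmtU (inT N t).
have ff (b : forall u : tU L, stalk u) :
    on_stalk (r := th1 N) (b (th1 N (inT N t))) =
    stalk_map (esym (inU_th1 t)) (b (inU L (h1 N t))) by rewrite stalk_mapE.
(* [v0] lives at th1 (inT t), whereas [al] will be evaluated at inU (h1 t); the two points are equal
   only by proof. *)
have [v [[vB vZ] vE]] :=
  semilinear_form_transport (M := OmtU) (esym (inU_th1 t)) ff hv0.
have vd (b : forall u : tU L, stalk u) : v (diff OmtU (b (inU L (h1 N t)))) =
    on_stalk (r := th2 N) (b (th2 N (inT N t))) -
    on_stalk (r := th1 N) (b (th1 N (inT N t))).
  by rewrite (vE (fun u => diff OmtU (b u))) v0d.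
(* The maps from differentials to functions on tT and on T are compatible with reduction: both sides
   are semilinear along the same homomorphism, so exact differentials suffice. *)
have red al' : on_stalk (r := inT N) (v al') = dT (diff_pull OmU al').
  rewrite thUE; pose f r := on_stalk (r := h1 N) (on_stalk (r := inU L) (x := h1 N t) r).
  have hi := inT_hom t.
  apply: (kahler_form_ext (@diff_kahler _ _ _ OmtU (inU L (h1 N t))) (f := f)
    (g1 := fun m => on_stalk (r := inT N) (v m)) (g2 := fun m => dT (thU m))).
  - split=> [m m'|r m]; first by rewrite vB (ring_homB hi).
    rewrite vZ (ring_homM hi); congr (_ * _).
    by have [b [_ <-]] := germ_ex r; rewrite stalk_mapE /f h1_stalk.
  - by split=> [m m'|r m]; [rewrite thUB dTB|rewrite thUZ dTZ].
  - move=> r; have [b [_ <-]] := germ_ex r.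
    rewrite thUd vd (ring_homB hi) -h1_stalk -h2_stalk.
    pose b' u := on_stalk (r := inU L) (x := u) (b (inU L u)).
    by rewrite -[on_stalk (b (inU L (h1 N t)))]/(b' (h1 N t)) (dTa b').
pose b u := on_stalk (r := F) (x := u) (a (F u)).
rewrite -[LHS](vd b) [diff OmtU _]ed (zmod_morphismMn vB).
rewrite -(tpE (Q := QT) (inT_red N) (fun y => tT_p2 (inT N y))).
by congr times_p; rewrite red eal.
Qed.

End Conclusion.

Theorem proposition1p10 (p : nat) (p_prime : prime p)
    (D : lifted_frobenius_twist p) (L : lifted_open D)
    (N : diagonal_neighborhood L)
    (Om : differentials (X'S D)) (OmU : differentials (US L))
    (OmtX' : differentials (tX'S D)) (OmtU : differentials (tUS L))
    (F : raw_morphism (tU L) (tX' D))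
    (F_lifting : lifting (Q := liftings_U L) setT F)
    (zeta : forall u : U_ L, Om (relFU L u) -> OmU u)
    (zetaP : is_divided_differential OmtX' OmtU F zeta)
    (V' : set (X'_ D)) (V'_open : open V')
    (w : forall z : X'_ D, Om z) (w_section : forall z, V' z -> mregular w z) :
  let V := relFU L @^-1` V' in
  let sigma_w := splitting (Q := liftings_U L) F (one_tensor w) in
  affine_function (Q := liftings_U L) V sigma_w /\
  torsor_function_eq (Q := liftings_T N) (h1 N @^-1` V)
    (nabla N sigma_w)
    (constant_function Om (Q := liftings_T N)
      (fun t => - differential_in_T (zeta (h1 N t) (w (relFU L (h1 N t)))))).
Proof.
move=> V sigma_w; split.
  exact: (splitting_affine (Q := liftings_U L) (inU_red L)
    (@relFU_mor _ _ L) (fun y => tU_p2 (inU L y))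
    (fun y => @tU_torsion _ p_prime _ L (inU L y)) F_lifting w_section).
split=> [W G lG t Vt Wt|t Vt].
  have p2 (y : T_ N) := tT_p2 (inT N y).
  have tor (y : T_ N) := @tT_torsion _ p_prime _ L N OmtU (inT N y).
  have base1 : eq_mor (mor_comp (tUS L) (th1 N)) (mor_comp (tUS L) (th1 N)).
    by move=> y _.
  have base2 : eq_mor (mor_comp (tUS L) (th2 N)) (mor_comp (tUS L) (th1 N)).
    by move=> y _; have [e E] := tUS_th y; split=> // s; apply/esym/E.
  have phi1 : eq_mor (mor_comp (relFU L) (h1 N)) (mor_comp (relFU L) (h1 N)).
    by move=> y _.
  have [oW _ _ _] := lG.
  have lF2 := lifting_restrict (Q := liftings_T N)
    (lifting_pull (@th2_mor _ _ _ N) (h2_red N) (@relFU_h12 _ _ _ N)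
    base2 F_lifting) oW (fun _ _ => I).
  have [x2 hx2] := difference_at_ex (Q := liftings_T N) Om (inT_red N)
    (@phiT_mor _ _ _ N) p2 tor lF2 lG Wt.
  have [dT [hdT dTa dTE]] := differential_in_T_form OmU t.
  have hz := zeta_difference F_lifting zetaP hdT dTa.
  (* G - F \o th1 is the sum of F \o th2 - F \o th1 and G - F \o th2; since [nabla] subtracts the
     [h1] term, the zeta contribution enters with a minus sign. *)
  have hx1 := difference_at_add (Q := liftings_T N) (inT_red N) p2 hz hx2.
  have v2 := pull_value p_prime OmtU (h2_mor N) (@th2_mor _ _ _ N) (h2_red N)
    (@relFU_h12 _ _ _ N) base2 w F_lifting lG Wt hx2.
  have v1 := pull_value p_prime OmtU (h1_mor N) (@th1_mor _ _ _ N) (h1_red N)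
    phi1 base1 w F_lifting lG Wt hx1.
  have -> : value (nabla N sigma_w) G t =
      x2 (w (relFU L (h1 N t))) - (dT (zeta (h1 N t) (w (relFU L (h1 N t)))) +
        x2 (w (relFU L (h1 N t)))) by apply: (congr2 (fun a b => a - b) v2 v1).
  by rewrite /= dTE opprD addrCA subrr addr0.
(* Linear parts: both pullbacks of the section 1 (x) w have linear part 1 (x) w, so they cancel and
   leave the zero linear part of a constant function. *)
move=> M g [gB gZ].
rewrite /= /one_tensor /= !big_cons !big_nil /=.
rewrite (ring_hom1 (morphism_stalk_hom t (h2_mor N))).
rewrite (ring_hom1 (morphism_stalk_hom t (h1_mor N))).
by rewrite scale1r scaleN1r addr0 subrr.
Qed.
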